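(* For every $n\geq 1$ and every permutation $\sigma:X\to X$ of $X=\{1,\dots,n\}$, the permutation Jones polynomial $J_\sigma$ is an invariant of oriented classical and virtual knots and links; that is, if $D$ and $D'$ are diagrams of oriented classical or virtual knots or links related by Reidemeister moves (classical, purely virtual and mixed virtual), then $J_\sigma(D)=J_\sigma(D')$.
   Context: Diagrams are oriented link diagrams in the plane with classical crossings and possibly virtual crossings. Reidemeister moves are: the oriented classical moves I, II, III; the purely virtual moves I, II, III (all crossings virtual); and the mixed virtual move (a strand having only virtual crossings with the others is moved past a classical crossing); planar isotopy is always allowed. Colorings. A semiarc of $D$ is an edge of the graph obtained by regarding the classical crossing points as vertices (virtual crossings are ignored; a component with no classical crossing is a single semiarc). A $\sigma$-coloring of $D$ assigns an element of $X$ to each semiarc such that at each classical crossing of sign $\epsilon\in\{+1,-1\}$: if the incoming semiarc of the under-strand has color $x$, its outgoing semiarc has color $\sigma^{\epsilon}(x)$; if the incoming semiarc of the over-strand has color $y$, its outgoing semiarc has color $\sigma^{-\epsilon}(y)$. $\mathcal{C}_\sigma(D)$ is the set of $\sigma$-colorings of $D$. Monochromatic crossings. Draw a crossing with both strands oriented upward. It is monochromatic if the two semiarcs on its left side (one incoming, one outgoing, belonging to different strands) have equal colors, and polychromatic otherwise. (For a positive crossing the left semiarcs are the incoming over-semiarc and the outgoing under-semiarc; for a negative crossing they are the incoming under-semiarc and the outgoing over-semiarc.) States. A Kauffman state $s$ of a $\sigma$-colored diagram $d$ is obtained by replacing each monochromatic crossing by one of its two smoothings and each polychromatic crossing by a virtual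 crossing. A positive monochromatic crossing contributes a factor $a$ for the smoothing compatible with the orientation and $b$ for the other smoothing; a negative monochromatic crossing contributes $a^{-1}$ for the orientation-compatible smoothing and $b^{-1}$ for the other; a polychromatic crossing of sign $\epsilon$ contributes $v^{\epsilon}$. The product of these factors is the monomial $a^xb^yv^z$ of $s$; $|s|$ is the number of closed curves in $s$ (which may cross virtually); $\mathcal S(d)$ is the set of Kauffman states of $d$. The permutation Jones polynomial of a diagram $D$ is the Laurent polynomial in $a,b,v$ with integer coefficients $$J_\sigma(D)=\sum_{d\in\mathcal C_\sigma(D)}(-a^2b^{-1})^{-\mathrm{writhe}(D)}\sum_{s\in\mathcal S(d)}a^xb^yv^z(-ab^{-1}-ba^{-1})^{|s|},$$ where $\mathrm{writhe}(D)$ is the sum of the signs of the classical crossings of $D$. *)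

(* Defs.v *)
From Stdlib Require Import Relation_Operators.
From HB Require Import structures.
From mathcomp Require Import all_boot all_order all_fingroup all_algebra.
From mathcomp Require Import mpoly.

Set Implicit Arguments.
Unset Strict Implicit.
Unset Printing Implicit Defensive.

Import GRing.Theory.

Local Open Scope ring_scope.

Inductive crossing_kind := Positive | Negative | Virtual.

(* Local pieces of an oriented plane diagram whose edges are labelled in E.

   [Crossing k p q]: draw the crossing with both strands oriented upward.  Then
   p = (bottom left edge, top right edge) is the strand going up to the right
   and q = (bottom right edge, top left edge) the strand going up to the left,
   each listed as (incoming edge, outgoing edge).  The over-strand is p at a
   positive crossing and q at a negative one.

   [Point i o]: a marked point on a strand, where the edge i ends and the edge
   o starts.  Marked points carry no information; they let a curve without
   crossings be described by labels, as [Point e e]. *)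
Inductive node (E : Type) :=
  | Crossing of crossing_kind & E * E & E * E
  | Point of E & E.
Arguments Point {E} _ _.

Definition node_encode (E : Type) (x : node E) :
    option bool * ((E * E) * (E * E)) + E * E :=
  match x with
  | Crossing k p q =>
      inl (match k with
           | Positive => Some true | Negative => Some false | Virtual => None
           end, (p, q))
  | Point i o => inr (i, o)
  end.

Definition node_decode (E : Type)
    (x : option bool * ((E * E) * (E * E)) + E * E) : node E :=
  match x with
  | inl (k, (p, q)) =>
      Crossing (match k with
                | Some true => Positive | Some false => Negative
                | None => Virtual
                end) p q
  | inr (i, o) => Point i o
  end.

Lemma node_encodeK (E : Type) : cancel (@node_encode E) (@node_decode E).
Proof. by case=> [[] p q|i o]. Qed.

HB.instance Definition _ (E : eqType) :=
  Equality.copy (node E) (can_type (@node_encodeK E)).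

Definition incoming (E : Type) (x : node E) : seq E :=
  match x with Crossing _ p q => [:: p.1; q.1] | Point i _ => [:: i] end.

Definition outgoing (E : Type) (x : node E) : seq E :=
  match x with Crossing _ p q => [:: p.2; q.2] | Point _ o => [:: o] end.

Definition map_node (E F : Type) (f : E -> F) (x : node E) : node F :=
  match x with
  | Crossing k p q => Crossing k (f p.1, f p.2) (f q.1, f q.2)
  | Point i o => Point (f i) (f o)
  end.

Definition components (T : finType) (l : seq (T * T)) : nat :=
  n_comp [rel x y | ((x, y) \in l) || ((y, x) \in l)] (@predT T).

Definition node_links (E : Type) (x : node E) : seq (E * E) :=
  let s := incoming x ++ outgoing x in [seq (e, e') | e <- s, e' <- s].

(* The left side of an edge e (with respect to its orientation) is (e, true),
   the right side is (e, false).  Two sides are linked when they bound the same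
   quadrant of a crossing, here listed as south, east, north, west; the
   components of this relation are the boundary curves of the regions of the
   individual connected pieces of the diagram. *)
Definition side_links (E : Type) (x : node E) :
    seq ((E * bool) * (E * bool)) :=
  match x with
  | Crossing _ p q =>
      [:: ((p.1, false), (q.1, true)); ((q.1, false), (p.2, false));
          ((p.2, true), (q.2, false)); ((p.1, true), (q.2, true))]
  | Point i o => [:: ((i, true), (o, true)); ((i, false), (o, false))]
  end.

(* [planar] is Euler's formula V - E + F = 2 C, where C is the number of
   connected pieces of the diagram and F counts the faces of every piece
   separately: each piece is drawn without intersections other than its
   nodes on the sphere, equivalently in the plane.  Which region contains which
   other piece, and which region is unbounded, is not recorded. *)
Record diagram := Diagram {
  vertex : finType;
  edge : finType;
  node_at : vertex -> node edge;
  edge_ends : perm_eq (flatten [seq incoming (node_at x) | x <- enum vertex])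
                      (enum edge);
  edge_starts : perm_eq (flatten [seq outgoing (node_at x) | x <- enum vertex])
                        (enum edge);
  planar :
    (#|vertex|
     + components (flatten [seq side_links (node_at x) | x <- enum vertex])
     = #|edge|
       + 2 * components (flatten [seq node_links (node_at x) | x <- enum vertex])
    )%N
}.

(* [describes D l]: l lists the nodes of D, in some order, for some naming of
   its edges by natural numbers. *)
Definition describes (D : diagram) (l : seq (node nat)) : Prop :=
  exists2 f : edge D -> nat, injective f &
    perm_eq [seq map_node f (node_at x) | x <- enum (vertex D)] l.

(* How a strand s lies with respect to a strand t at their crossing. *)
Inductive level := Above | Below | Virtually.

Definition reverse_if (E : Type) (r : bool) (s : E * E) : E * E :=
  if r then (s.2, s.1) else s.

(* In a reference picture all strands go upward, s and t list their edges in
   this direction, and [s_left] says that s goes up to the right, i.e. enters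
   from the bottom left.  The flags r and r' tell which of the strands s and t
   are actually oriented downward; reversing one strand exchanges the roles of
   the two strands when the crossing is redrawn with both strands upward. *)
Definition cross (E : Type) (l : level) (s_left r r' : bool) (s t : E * E) :
    node E :=
  let s' := reverse_if r s in
  let t' := reverse_if r' t in
  if s_left (+) r (+) r' then
    Crossing (match l with
              | Above => Positive | Below => Negative | Virtually => Virtual
              end) s' t'
  else
    Crossing (match l with
              | Above => Negative | Below => Positive | Virtually => Virtual
              end) t' s'.

Definition strand (E : Type) (r : bool) (s : E * E) : node E :=
  let s' := reverse_if r s in Point s'.1 s'.2.

Definition height_level (h h' : nat) : level :=
  if (h' < h)%N then Above else Below.

(* The levels (first strand over/under second, first/third, second/third)
   allowed in a triangle move: three classical crossings between strands at
   three distinct heights, three virtual crossings, or exactly one classical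
   crossing, the remaining strand having only virtual crossings. *)
Inductive triangle_levels : level -> level -> level -> Prop :=
  | Triangle_classical (hA hB hC : nat) : uniq [:: hA; hB; hC] ->
      triangle_levels (height_level hA hB) (height_level hA hC)
                      (height_level hB hC)
  | Triangle_virtual : triangle_levels Virtually Virtually Virtually
  | Triangle_mixedC (l : level) : l <> Virtually ->
      triangle_levels l Virtually Virtually
  | Triangle_mixedB (l : level) : l <> Virtually ->
      triangle_levels Virtually l Virtually
  | Triangle_mixedA (l : level) : l <> Virtually ->
      triangle_levels Virtually Virtually l.

(* The two sides of a Reidemeister move inside a disc, for all orientations;
   the strand A runs (in the reference picture, from bottom to top) through the
   edges a0, a1, a2, and similarly for B and C.  In the triangle move A, B, C
   start at the bottom in this order from left to right and end in the order
   C, B, A: the two sides are the braid words s1 s2 s1 and s2 s1 s2. *)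
Inductive disc_move : seq (node nat) -> seq (node nat) -> Prop :=
  | Reidemeister1 (l : level) (left : bool) (a0 a1 a2 : nat) :
      disc_move [:: cross l left false false (a0, a1) (a1, a2)]
                [:: Point a0 a2]
  | Reidemeister2 (l : level) (rA rB : bool) (a0 a1 a2 b0 b1 b2 : nat) :
      disc_move [:: cross l true rA rB (a0, a1) (b0, b1);
                    cross l false rA rB (a1, a2) (b1, b2)]
                [:: strand rA (a0, a2); strand rB (b0, b2)]
  | Reidemeister3 (lAB lAC lBC : level) (rA rB rC : bool)
        (a0 a1 a2 b0 b1 b2 c0 c1 c2 : nat) :
      triangle_levels lAB lAC lBC ->
      disc_move [:: cross lAB true rA rB (a0, a1) (b0, b1);
                    cross lAC true rA rC (a1, a2) (c0, c1);
                    cross lBC true rB rC (b1, b2) (c1, c2)]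
                [:: cross lBC true rB rC (b0, b1) (c0, c1);
                    cross lAC true rA rC (a0, a1) (c1, c2);
                    cross lAB true rA rB (a1, a2) (b1, b2)].

(* Changing the names of vertices and edges, and removing a marked point
   between two distinct edges, do not change the diagram in the plane. *)
Inductive diagram_move (D D' : diagram) : Prop :=
  | Isotopy (l : seq (node nat)) :
      describes D l -> describes D' l -> diagram_move D D'
  | Unmark (a b : nat) (l : seq (node nat)) : a != b ->
      describes D (Point a b :: l) ->
      describes D' [seq map_node (fun e => if e == b then a else e) x | x <- l] ->
      diagram_move D D'
  | Reidemeister (L R rest : seq (node nat)) : disc_move L R ->
      describes D (L ++ rest) -> describes D' (R ++ rest) ->
      diagram_move D D'.

Definition reidemeister_equivalent : diagram -> diagram -> Prop :=
  clos_refl_sym_trans diagram diagram_move.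

Definition sign (E : Type) (x : node E) : int :=
  match x with
  | Crossing Positive _ _ => 1
  | Crossing Negative _ _ => -1
  | _ => 0
  end.

Definition writhe (D : diagram) : int :=
  \sum_(x : vertex D) sign (node_at x).

(* Laurent polynomials are viewed inside the fraction field of Z[a, b, v], which
   contains the Laurent polynomial ring as a subring. *)
Definition laurent : fieldType := {fraction {mpoly int[3]}}.

Definition var_a : laurent := tofrac ('X_(inord 0) : {mpoly int[3]}).
Definition var_b : laurent := tofrac ('X_(inord 1) : {mpoly int[3]}).
Definition var_v : laurent := tofrac ('X_(inord 2) : {mpoly int[3]}).

Section PermutationJones.

Variables (n : nat) (sigma : {perm 'I_n}) (D : diagram).

(* A coloring of semiarcs is given as a coloring of edges which is constant
   along every semiarc, i.e. across virtual crossings and marked points.  At a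
   positive crossing p is over (exponent -1) and q under (exponent +1); at a
   negative crossing p is under (exponent -1) and q over (exponent +1), so the
   two conditions coincide. *)
Definition is_coloring (c : {ffun edge D -> 'I_n}) : bool :=
  [forall x : vertex D,
    match node_at x with
    | Crossing Positive p q | Crossing Negative p q =>
        (c p.2 == (sigma^-1)%g (c p.1)) && (c q.2 == sigma (c q.1))
    | Crossing Virtual p q => (c p.2 == c p.1) && (c q.2 == c q.1)
    | Point i o => c o == c i
    end].

Definition monochromatic (c : {ffun edge D -> 'I_n}) : {set vertex D} :=
  [set x | match node_at x with
           | Crossing Virtual _ _ | Point _ _ => false
           | Crossing _ p q => c p.1 == c q.2
           end].

(* A Kauffman state is encoded by the set s of those monochromatic crossings
   which receive the smoothing compatible with the orientation. *)
Definition vertex_factor (c : {ffun edge D -> 'I_n}) (s : {set vertex D})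
    (x : vertex D) : laurent :=
  let y := if x \in monochromatic c then if x \in s then var_a else var_b
           else var_v in
  y ^ sign (node_at x).

Definition state_links (c : {ffun edge D -> 'I_n}) (s : {set vertex D})
    (x : vertex D) : seq (edge D * edge D) :=
  match node_at x with
  | Crossing _ p q =>
      if x \in monochromatic c then
        if x \in s then [:: (p.1, q.2); (q.1, p.2)]
        else [:: (p.1, q.1); (p.2, q.2)]
      else [:: (p.1, p.2); (q.1, q.2)]
  | Point i o => [:: (i, o)]
  end.

Definition closed_curves (c : {ffun edge D -> 'I_n}) (s : {set vertex D}) :
    nat :=
  components (flatten [seq state_links c s x | x <- enum (vertex D)]).

Definition permutation_jones : laurent :=
  \sum_(c | is_coloring c)
    (- (var_a ^+ 2 * var_b^-1)) ^ (- writhe D) *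
    \sum_(s : {set vertex D} | s \subset monochromatic c)
      (\prod_(x : vertex D) vertex_factor c s x) *
      (- (var_a * var_b^-1) - var_b * var_a^-1) ^+ closed_curves c s.

End PermutationJones.

(* Main.v *)
Require Import Defs.
From Stdlib Require Import Relation_Operators.
From mathcomp Require Import all_boot all_fingroup all_algebra.
From mathcomp Require mpoly.
From mathcomp Require Import ring.

(* Once the writhe factor is distributed over the crossings, the state sum of a
   fixed coloring can be evaluated node by node, so a Reidemeister move only has
   to be checked inside its disc, after deleting the edges in the interior.

   Draw all strands in the disc upward.  A monochromatic crossing then
   contributes x (vertical smoothing) + y (horizontal smoothing), where y / x is
   a / b or b / a according to which strand is on top, whatever the orientations;
   any other crossing contributes a multiple of the virtual crossing.  Moves I
   and II are short computations with circle = - a / b - b / a.  In move III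
   being monochromatic is a transitive relation between the three strands, so
   the monochromatic crossings are either all three, and the usual computation
   with the Kauffman bracket applies, or at most one, and then a strand is
   moved virtually past each of its smoothings. *)

Set Implicit Arguments.
Unset Strict Implicit.
Unset Printing Implicit Defensive.

Import GRing.Theory.

(** * Counting closed curves *)

(** Two obstacles shape the formalization. The two sides of a move have different edge types, so
    both are renamed into one ordinal type, and colorings take a fixed value [c0] on labels not in
    use. Moreover boundary edges of a disc may coincide, since a strand can leave the disc and
    reenter along the same edge. Hence moves are checked on templates labelled by distinct numerals,
    which a map [rho], not injective in general, places in the diagram. Colorings survive the moves
    because crossing another strand applies [sigma] or its inverse according to the direction of
    crossing, never according to over and under. All these changes commute, and the colors inside a
    disc are determined by those at the bottom. *)

Definition map_link (E F : Type) (f : E -> F) (p : E * E) : F * F :=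
  (f p.1, f p.2).

Definition rename (E : eqType) (y x z : E) : E := if z == y then x else z.

Definition within (E : eqType) (V : seq E) (k : seq (E * E)) : bool :=
  all (fun p => (p.1 \in V) && (p.2 \in V)) k.

Definition adj (E : eqType) (k : seq (E * E)) : rel E :=
  [rel x y | ((x, y) \in k) || ((y, x) \in k)].

Definition curves (T : finType) (V : seq T) (k : seq (T * T)) : nat :=
  n_comp (adj k) [in V].

Lemma adj_cat (E : eqType) (k m : seq (E * E)) x y :
  adj (k ++ m) x y = adj k x y || adj m x y.
Proof. by rewrite /adj /= !mem_cat orbACA. Qed.

Lemma adj_map (E F : eqType) (f : E -> F) (k : seq (E * E)) x y :
  reflect (exists u w, [/\ adj k u w, x = f u & y = f w])
          (adj (map (map_link f) k) x y).
Proof.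
apply: (iffP orP) => [[] /mapP[[u w] kuw] [-> ->]|[u [w [/orP[] kuw -> ->]]]].
- by exists u, w; rewrite /adj /= kuw.
- by exists w, u; rewrite /adj /= kuw orbT.
- by left; apply/mapP; exists (u, w).
- by right; apply/mapP; exists (w, u).
Qed.

Lemma withinP (E : eqType) (V : seq E) (k : seq (E * E)) :
  reflect (forall x y, adj k x y -> x \in V /\ y \in V) (within V k).
Proof.
apply: (iffP allP) => [kV x y /orP[] /kV /andP[]//| kV [x y] kxy].
by apply/andP/kV; rewrite /adj /= kxy.
Qed.

Lemma within_cat (E : eqType) (V : seq E) (k m : seq (E * E)) :
  within V (k ++ m) = within V k && within V m.
Proof. exact: all_cat. Qed.

Lemma sub_within (E : eqType) (V V' : seq E) (k : seq (E * E)) :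
  {subset V <= V'} -> within V k -> within V' k.
Proof. by move=> sVV'; apply: sub_all => p /andP[/sVV'-> /sVV'->]. Qed.

Section Curves.
Variable T : finType.
Implicit Types (V : seq T) (k m : seq (T * T)).

Lemma adj_sym k : connect_sym (adj k).
Proof. by apply: sym_connect_sym => x y; apply: orbC. Qed.

Lemma adj_closed V k : within V k -> closed (adj k) [in V].
Proof. by move/withinP=> kV x y /kV[xV yV]; apply: etrans xV (esym yV). Qed.

Lemma eq_curves V V' k k' :
  V =i V' -> adj k =2 adj k' -> curves V k = curves V' k'.
Proof.
move=> eV ek; rewrite /curves (eq_n_comp (eq_connect ek)).
exact: eq_n_comp_r.
Qed.

Lemma connect_homo (T1 T2 : finType) (e : rel T1) (e' : rel T2) (h : T1 -> T2) :
  (forall x y, e x y -> connect e' (h x) (h y)) ->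
  forall x y, connect e x y -> connect e' (h x) (h y).
Proof.
move=> he x y /connectP[p + ->]; elim: p x => [|z p IHp] x /=.
  by rewrite connect0.
by case/andP=> /he xz /IHp; apply: connect_trans.
Qed.

(** Merging y into x moves every label within its own component, hence induces a bijection of
    components; [adjunction_n_comp] turns this into an equality of counts. *)
Lemma curves_contract V k x y :
  y \notin V -> x \in V -> adj k y x -> within (y :: V) k ->
  curves (y :: V) k = curves V (map (map_link (rename y x)) k).
Proof.
move=> yV xV kyx kV; set h := rename y x; set k' := map _ k.
have hk z : connect (adj k) z (h z).
  rewrite /h /rename; case: eqP => [->|_]; last exact: connect0.
  exact: connect1.
have hV z : (h z \in V) = (z \in y :: V).
  by rewrite /h /rename inE; case: eqP.
have k'V : within V k'.
  by apply/withinP=> u w /adj_map[z [t [/(withinP _ _ kV)[zV tV] -> ->]]]; rewrite !hV.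
rewrite /curves (@adjunction_n_comp _ _ h _ _ (adj_sym k') (adj_sym k)).
- by apply: eq_n_comp_r => z; rewrite !inE hV inE.
- exact: adj_closed.
split=> [z zV|z t _].
  exists z; rewrite /h /rename; case: eqP => [zy|_]; last exact: connect0.
  by move: yV; rewrite -zy; case/negP.
apply/idP/idP.
  by apply: connect_homo => u w kuw; apply/connect1/adj_map; exists u, w.
move=> k'ht; apply: connect_trans (hk z) _; rewrite adj_sym.
apply: connect_trans (hk t) _; rewrite adj_sym; move: k'ht.
apply: connect_sub => u w /adj_map[z' [t' [kzt -> ->]]].
by rewrite adj_sym (connect_trans _ (hk _)) // adj_sym (connect_trans _ (hk _)) // connect1.
Qed.

(** Here y is a component by itself, that is, a closed curve; dropping its self-links does not
    affect connectivity. *)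
Lemma curves_isolated V k y :
  y \notin V -> (forall z, adj k y z -> z = y) ->
  curves (y :: V) k = (curves V [seq p <- k | p != (y, y)]).+1.
Proof.
move=> yV ky; set k' := filter _ k.
have ek : connect (adj k) =2 connect (adj k').
  have ak u w : adj k' u w = ((u, w) != (y, y)) && adj k u w.
    by rewrite /k' /adj /= !mem_filter andb_orr !xpair_eqE [in _ && (_ == y)]andbC.
  move=> u w; apply/idP/idP; apply: connect_sub => {u w} u w kuw.
    case E: ((u, w) == (y, y)); first by case/eqP: E => -> ->; apply: connect0.
    by apply: connect1; rewrite ak E.
  by apply: connect1; move: kuw; rewrite ak => /andP[].
rewrite /curves (eq_n_comp ek) /n_comp_mem.
have ry : roots (adj k') y.
  rewrite /roots; apply/eqP.
  have: connect (adj k) y (fingraph.root (adj k') y) by rewrite ek connect_root.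
  case/connectP=> p + ->; elim: p => //= z p IHp /andP[/ky -> /IHp//].
(* [cardU1] counts an added element by the boolean [y \notin V], so the 1 is brought into that
   form. *)
rewrite -add1n -[1]/(nat_of_bool true) -yV.
set A := predI _ (mem V).
have -> : (y \notin V) = (y \notin A) by rewrite !inE ry.
rewrite -cardU1; apply: eq_card => z; rewrite !inE.
by case: eqP => [->|//] /=; rewrite andbT.
Qed.

End Curves.

Lemma curves_map (T T' : finType) (f : T -> T') (V : seq T) (k : seq (T * T)) :
  injective f -> within V k ->
  curves (map f V) (map (map_link f) k) = curves V k.
Proof.
move=> injf kV.
have k'V : within (map f V) (map (map_link f) k).
  apply/withinP=> _ _ /adj_map[z [t [/(withinP _ _ kV)[zV tV] -> ->]]].
  by rewrite !map_f.
rewrite /curves (@adjunction_n_comp _ _ f _ _ (adj_sym _) (adj_sym k)).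
- by apply: eq_n_comp_r => z; rewrite !inE mem_map.
- exact: adj_closed.
apply: strict_adjunction => //; [exact: adj_sym | exact: adj_closed | |].
  by apply/subsetP=> _ /mapP[t _ ->]; apply: codom_f.
move=> u w _; apply/adj_map/idP => [[u' [w' [kuw /injf-> /injf->]]]//|kuw].
by exists u, w.
Qed.

(** * State sums over lists of nodes *)

(** Curves of a state are unoriented: the order, direction and repetition of links must not
    matter. *)
Definition link_invariant (E : eqType) (A : Type) (K : seq (E * E) -> A) : Prop :=
  forall k k', adj k =2 adj k' -> K k = K k'.

Lemma link_invariant_cat (E : eqType) (A : Type) (K : seq (E * E) -> A) p :
  link_invariant K -> link_invariant (fun k => K (p ++ k)).
Proof.
by move=> Kadj k k' kk'; apply: Kadj => x y; rewrite !adj_cat kk'.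
Qed.

Lemma link_invariant_cat2 (E : eqType) (A : Type) (K : seq (E * E) -> A) p q :
  link_invariant K -> link_invariant (fun k => K (p ++ q ++ k)).
Proof. by move/(link_invariant_cat p)/(link_invariant_cat q). Qed.

Definition endpoints (E : Type) (x : node E) : seq E := incoming x ++ outgoing x.

Definition ins (E : Type) (l : seq (node E)) : seq E := flatten (map (@incoming E) l).
Definition outs (E : Type) (l : seq (node E)) : seq E := flatten (map (@outgoing E) l).
Definition labels (E : Type) (l : seq (node E)) : seq E :=
  flatten (map (@endpoints E) l).

Lemma ins_map (E E' : Type) (f : E -> E') l :
  ins (map (map_node f) l) = map f (ins l).
Proof. by elim: l => //= -[k p q|i o] l; rewrite /ins /= => ->. Qed.

Lemma outs_map (E E' : Type) (f : E -> E') l :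
  outs (map (map_node f) l) = map f (outs l).
Proof. by elim: l => //= -[k p q|i o] l; rewrite /outs /= => ->. Qed.

Lemma ins_cat (E : Type) (l l' : seq (node E)) : ins (l ++ l') = ins l ++ ins l'.
Proof. by rewrite /ins map_cat flatten_cat. Qed.

Lemma outs_cat (E : Type) (l l' : seq (node E)) :
  outs (l ++ l') = outs l ++ outs l'.
Proof. by rewrite /outs map_cat flatten_cat. Qed.

Lemma labels_cons (E : Type) (x : node E) l :
  labels (x :: l) = endpoints x ++ labels l.
Proof. by []. Qed.

Lemma labelsE (E : eqType) (l : seq (node E)) e :
  (e \in labels l) = (e \in ins l) || (e \in outs l).
Proof.
elim: l => //= x l IHl.
rewrite /labels /ins /outs /= !mem_cat -/(labels l) IHl.
by rewrite -/(ins l) -/(outs l); do 4 case: (e \in _).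
Qed.

Section Bracket.
Variables (n : nat) (sigma : {perm 'I_n}) (F : fieldType) (a b v : F).

Local Open Scope ring_scope.

Definition writhe_unit : F := - (a ^+ 2 * b^-1).
Definition circle : F := - (a * b^-1) - b * a^-1.

(* The writhe normalization is distributed over the crossings. *)
Definition weight (y : F) (s : int) : F := (y * writhe_unit^-1) ^ s.

Lemma writhe_unit_neq0 : a != 0 -> b != 0 -> writhe_unit != 0.
Proof. by move=> a0 b0; rewrite oppr_eq0 mulf_neq0 ?expf_neq0 ?invr_eq0. Qed.

Section Node.
Variables (E : eqType) (c : E -> 'I_n).

Definition colored (x : node E) : bool :=
  match x with
  | Crossing Positive p q | Crossing Negative p q =>
      (c p.2 == (sigma^-1)%g (c p.1)) && (c q.2 == sigma (c q.1))
  | Crossing Virtual p q => (c p.2 == c p.1) && (c q.2 == c q.1)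
  | Point i o => c o == c i
  end.

Definition mono (x : node E) : bool :=
  match x with
  | Crossing Virtual _ _ | Point _ _ => false
  | Crossing _ p q => c p.1 == c q.2
  end.

Definition smoothing (o : bool) (x : node E) : F * seq (E * E) :=
  match x with
  | Crossing _ p q =>
      if mono x then
        if o then (weight a (sign x), [:: (p.1, q.2); (q.1, p.2)])
        else (weight b (sign x), [:: (p.1, q.1); (p.2, q.2)])
      else (weight v (sign x), [:: (p.1, p.2); (q.1, q.2)])
  | Point i o => (1, [:: (i, o)])
  end.

Definition smoothings (x : node E) : seq (F * seq (E * E)) :=
  if mono x then [:: smoothing true x; smoothing false x]
  else [:: smoothing true x].

(* The sum over all states of the nodes in l; K is applied to the links of the
   state, so that a partial state sum can be continued outside of l. *)
Fixpoint bracket (l : seq (node E)) (K : seq (E * E) -> F) : F :=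
  if l is x :: l' then
    \sum_(t <- smoothings x) t.1 * bracket l' (fun k => K (t.2 ++ k))
  else K [::].

Lemma eq_bracket l K K' : K =1 K' -> bracket l K = bracket l K'.
Proof.
elim: l K K' => [|x l IHl] K K' eK /=; first exact: eK.
by apply: eq_bigr => t _; congr (_ * _); apply: IHl => k.
Qed.

Lemma bracket_cat l l' K :
  bracket (l ++ l') K = bracket l (fun k => bracket l' (fun m => K (k ++ m))).
Proof.
elim: l K => [|x l IHl] K //=; apply: eq_bigr => t _; congr (_ * _).
rewrite IHl; apply: eq_bracket => k; apply: eq_bracket => m.
by rewrite catA.
Qed.

Lemma bracket_sum (I : Type) (r : seq I) (w : I -> F) l H :
  bracket l (fun m => \sum_(t <- r) w t * H t m) =
  \sum_(t <- r) w t * bracket l (H t).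
Proof.
elim: l H => [|x l IHl] H //=.
under eq_bigr => t _ do rewrite IHl mulr_sumr.
rewrite exchange_big; apply: eq_bigr => i _; rewrite mulr_sumr.
by apply: eq_bigr => t _; rewrite mulrCA.
Qed.

Lemma smoothing_within o x : within (endpoints x) (smoothing o x).2.
Proof.
case: x => [k p q|i o'] /=; last by rewrite !inE !eqxx ?orbT.
by do 2?case: ifP => _ /=; rewrite !inE !eqxx ?orbT.
Qed.

Lemma smoothings_within x t : t \in smoothings x -> within (endpoints x) t.2.
Proof.
rewrite /smoothings; case: ifP => _; rewrite !inE.
  by case/orP=> /eqP->; apply: smoothing_within.
by move/eqP->; apply: smoothing_within.
Qed.

Lemma eq_bracket_within l K K' :
  (forall k, within (labels l) k -> K k = K' k) -> bracket l K = bracket l K'.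
Proof.
elim: l K K' => [|x l IHl] K K' eK /=; first exact: eK.
rewrite !big_seq; apply: eq_bigr => t /smoothings_within tx.
congr (_ * _); apply: IHl => k kl; apply: eK.
rewrite within_cat (sub_within _ tx) ?(sub_within _ kl) // => e.
  by rewrite labels_cons mem_cat orbC => ->.
by rewrite labels_cons mem_cat => ->.
Qed.

End Node.

(** An exchange of finite sums, available because [bracket] is linear in its continuation. It lets
    the outside of a disc be smoothed before the disc. *)
Lemma bracket_exchange (E E' : eqType) (c : E -> 'I_n) (c' : E' -> 'I_n) l l' G :
  bracket c l (fun k => bracket c' l' (fun m => G k m)) =
  bracket c' l' (fun m => bracket c l (fun k => G k m)).
Proof.
elim: l G => [|x l IHl] G //=.
under eq_bigr => t _ do rewrite IHl.
by rewrite bracket_sum.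
Qed.


Lemma eq_in_smoothings (E : eqType) (c c' : E -> 'I_n) x :
  {in endpoints x, c =1 c'} -> smoothings c x = smoothings c' x.
Proof.
case: x => [k p q|//] cc'; rewrite /smoothings /smoothing /mono.
by rewrite !cc' // !inE !eqxx ?orbT.
Qed.

Lemma eq_in_colored (E : eqType) (c c' : E -> 'I_n) x :
  {in endpoints x, c =1 c'} -> colored c x = colored c' x.
Proof.
case: x => [k p q|i o] cc' /=; last by rewrite !cc' // !inE !eqxx ?orbT.
by rewrite !cc' // !inE !eqxx ?orbT.
Qed.

Lemma eq_in_all_colored (E : eqType) (c c' : E -> 'I_n) l :
  {in labels l, c =1 c'} -> all (colored c) l = all (colored c') l.
Proof.
move=> cc'; apply: eq_in_all => x xl; apply: eq_in_colored => e ex.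
by apply: cc'; apply/flattenP; exists (endpoints x); rewrite ?map_f.
Qed.

Lemma eq_in_bracket (E : eqType) (c c' : E -> 'I_n) l K :
  {in labels l, c =1 c'} -> bracket c l K = bracket c' l K.
Proof.
elim: l K => //= x l IHl K cc'.
rewrite (@eq_in_smoothings _ c c') => [|e ex].
  apply: eq_bigr => t _; congr (_ * _); apply: IHl => e el.
  by apply: cc'; rewrite labels_cons mem_cat el orbT.
by apply: cc'; rewrite labels_cons mem_cat ex.
Qed.

Lemma all_colored_map (E E' : eqType) (f : E -> E') (c : E' -> 'I_n) l :
  all (colored c) (map (map_node f) l) = all (colored (c \o f)) l.
Proof. by rewrite all_map; apply: eq_all => -[[] p q|i o]. Qed.

Lemma bracket_map (E E' : eqType) (f : E -> E') (c : E' -> 'I_n) l K :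
  bracket c (map (map_node f) l) K =
  bracket (c \o f) l (fun k => K (map (map_link f) k)).
Proof.
elim: l K => //= x l IHl K.
have -> : smoothings c (map_node f x) =
          [seq (t.1, map (map_link f) t.2) | t <- smoothings (c \o f) x].
  by case: x => [[] p q|i o] //; rewrite /smoothings /=; case: ifP => m_x; rewrite /= ?m_x.
rewrite big_map; apply: eq_bigr => t _ /=; congr (_ * _).
by rewrite IHl; apply: eq_bracket => k; rewrite map_cat.
Qed.

Lemma bracket_perm (E : eqType) (c : E -> 'I_n) l l' K :
  link_invariant K -> perm_eq l l' ->
  bracket c l K = bracket c l' K.
Proof.
move=> Kadj; apply/catCA_perm_subst: l l' => s1 s2 s3.
transitivity (bracket c s1 (fun k1 => bracket c s2 (fun k2 =>
                bracket c s3 (fun k3 => K (k1 ++ k2 ++ k3))))).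
  by rewrite bracket_cat; apply: eq_bracket => k1; rewrite bracket_cat.
rewrite bracket_exchange bracket_cat; apply: eq_bracket => k2.
rewrite bracket_cat; apply: eq_bracket => k1; apply: eq_bracket => k3.
by apply: Kadj => x y; rewrite !adj_cat orbCA.
Qed.

End Bracket.

(** * State sums over colorings and sets of crossings *)

Section FiniteSums.

Local Open Scope ring_scope.

Lemma sum_subsetU1 (R : nmodType) (I : finType) (i : I) (A : {set I})
    (G : {set I} -> R) : i \notin A ->
  \sum_(s : {set I} | s \subset i |: A) G s =
  \sum_(s : {set I} | s \subset A) (G (i |: s) + G s).
Proof.
move=> iA; rewrite (bigID (fun s : {set I} => i \in s)) big_split /=.
congr (_ + _).
  rewrite (reindex_onto (fun s => i |: s) (fun s => s :\ i)) /=; last first.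
    by move=> s /andP[_ iS]; rewrite setD1K.
  apply: eq_bigl => s; rewrite setU11 andbT.
  apply/andP/idP => [[sA /eqP <-]|sA].
    by rewrite subDset.
  split; first by rewrite setUS.
  have iS : i \notin s by apply: contra iA; apply/subsetP.
  by rewrite setU1K.
apply: eq_bigl => s; apply/andP/idP => [[sA iS]|sA].
  by rewrite -(setU1K iA) subsetD1 sA.
by rewrite subsetU ?sA ?orbT //; split=> //; apply: contra iA; apply/subsetP.
Qed.

Lemma prodr_exprz (F : fieldType) (I : Type) (r : seq I) (x : F) (s : I -> int) :
  x != 0 -> x ^ (\sum_(i <- r) s i) = \prod_(i <- r) x ^ s i.
Proof.
move=> x0; elim: r => [|i r IHr]; first by rewrite !big_nil expr0z.
by rewrite !big_cons expfzDr // IHr.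
Qed.

End FiniteSums.

Section StateSum.
Variables (n : nat) (sigma : {perm 'I_n}) (F : fieldType) (a b v : F).

Local Open Scope ring_scope.

Local Notation bracket := (bracket a b v).
Local Notation circle := (circle a b).

(** Choosing a set of monochromatic crossings amounts to a binary choice at each of them: by
    induction on [r], the sets are split by whether they contain the first index. *)
Lemma bracket_states (E : eqType) (c : E -> 'I_n) (I : finType)
    (x_ : I -> node E) (r : seq I) K : uniq r ->
  \sum_(s : {set I} | s \subset [set i in r | mono c (x_ i)])
    (\prod_(i <- r) (smoothing a b v c (i \in s) (x_ i)).1) *
    K (flatten [seq (smoothing a b v c (i \in s) (x_ i)).2 | i <- r]) =
  bracket c (map x_ r) K.
Proof.
elim: r K => [|i r IHr] K /=.
  rewrite (_ : finset _ = set0); last by apply/setP=> j; rewrite !inE.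
  rewrite (big_pred1 set0) => [_|s]; last by rewrite subset0.
  by rewrite big_nil mul1r.
case/andP=> ir ur; set A := [set j in r | mono c (x_ j)].
have iA : i \notin A by rewrite !inE negb_and ir.
pose B o (t : {set I}) K' := (smoothing a b v c o (x_ i)).1 *
  ((\prod_(j <- r) (smoothing a b v c (j \in t) (x_ j)).1) *
   K' (flatten [seq (smoothing a b v c (j \in t) (x_ j)).2 | j <- r])).
(* Membership of [i] is visible only at the head, so in the tail [s] may be replaced by any set
   agreeing with it on [r]. *)
have GE (s t : {set I}) : {in r, forall j, (j \in s) = (j \in t)} ->
  (\prod_(j <- i :: r) (smoothing a b v c (j \in s) (x_ j)).1) *
  K (flatten [seq (smoothing a b v c (j \in s) (x_ j)).2 | j <- i :: r]) =
  B (i \in s) t (fun k => K ((smoothing a b v c (i \in s) (x_ i)).2 ++ k)).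
  move=> st; rewrite big_cons -mulrA /B; congr (_ * (_ * _)).
    by rewrite !big_seq; apply: eq_bigr => j /st->.
  congr (K (_ ++ flatten _)).
  by apply/eq_in_map => j /st->.
case: (boolP (mono c (x_ i))) => m_i.
  have -> : [set j in i :: r | mono c (x_ j)] = i |: A.
    by apply/setP=> j; rewrite !inE; case: eqP => // ->; rewrite m_i.
  rewrite sum_subsetU1 // big_split /smoothings m_i /= big_cons big_seq1.
  congr (_ + _); rewrite -IHr // big_distrr /=; apply: eq_bigr => s sA.
    rewrite (GE _ s) ?setU11 // => j jr; rewrite !inE.
    by case: eqP jr ir => // -> ->.
  rewrite (GE _ s) // (_ : (i \in s) = false) //.
  by apply: contraNF iA; apply/subsetP.
have -> : [set j in i :: r | mono c (x_ j)] = A.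
  by apply/setP=> j; rewrite !inE; case: eqP => // ->; rewrite (negPf m_i) !andbF.
rewrite /smoothings (negPf m_i) big_seq1 -IHr // big_distrr /=.
apply: eq_bigr => s sA; rewrite (GE _ s) //.
suff eqb : smoothing a b v c (i \in s) (x_ i) = smoothing a b v c true (x_ i).
  by rewrite /B eqb.
by case: (x_ i) m_i => // k p q m_i; rewrite /smoothing (negPf m_i).
Qed.

(* c0 is the color of the labels not in use, so that the colorings of diagrams
   with different edges can be compared within one type. *)
Variable c0 : 'I_n.

Definition supported (T : finType) (V : seq T) (c : {ffun T -> 'I_n}) : bool :=
  [forall x, (x \in V) || (c x == c0)].

(** Curves are counted among [ins l], so elements of [T] that name no edge contribute neither
    colorings nor circles. In a closed picture every edge ends at a node, so [ins l] misses none. *)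
Definition statesum (T : finType) (l : seq (node T)) : F :=
  \sum_(c | supported (ins l) c && all (colored sigma c) l)
    bracket c l (fun k => circle ^+ curves (ins l) k).

Lemma eq_supported (T : finType) (V V' : seq T) : V =i V' ->
  supported V =1 supported V'.
Proof. by move=> eV c; apply: eq_forallb => x; rewrite eV. Qed.

Lemma perm_ins (T : eqType) (l l' : seq (node T)) :
  perm_eq l l' -> perm_eq (ins l) (ins l').
Proof. by move=> ll'; apply/perm_flatten/perm_map. Qed.

Lemma perm_outs (T : eqType) (l l' : seq (node T)) :
  perm_eq l l' -> perm_eq (outs l) (outs l').
Proof. by move=> ll'; apply/perm_flatten/perm_map. Qed.

Lemma statesum_perm (T : finType) (l l' : seq (node T)) :
  perm_eq l l' -> statesum l = statesum l'.
Proof.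
move=> ll'; have il := perm_mem (perm_ins ll').
apply: eq_big => [c|c _].
  by rewrite (eq_supported il) (perm_all _ ll').
rewrite (bracket_perm _ _ _ _ _ ll') => [|k k' kk'].
  by apply: eq_bracket => k; congr (_ ^+ _); apply: eq_curves.
by congr (_ ^+ _); apply: eq_curves.
Qed.

Lemma statesum_map (T T' : finType) (f : T -> T') (l : seq (node T)) :
  injective f -> (forall e, e \in ins l) ->
  statesum (map (map_node f) l) = statesum l.
Proof.
move=> injf full.
pose ext (c : {ffun T -> 'I_n}) : {ffun T' -> 'I_n} :=
  [ffun y => if [pick x | f x == y] is Some x then c x else c0].
have extf c x : ext c (f x) = c x.
  rewrite ffunE; case: pickP => [z /eqP/injf->//|/(_ x)].
  by rewrite eqxx.
rewrite /statesum (reindex_onto ext (fun c => [ffun x => c (f x)])) /=.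
  apply: eq_big => [c|c _].
    rewrite ins_map all_colored_map.
    have -> : supported (ins l) c.
      by apply/forallP=> x; rewrite full.
    have -> : supported (map f (ins l)) (ext c).
      apply/forallP=> y; rewrite ffunE; case: pickP => [x /eqP<-|_].
        by rewrite map_f ?full.
      by rewrite eqxx orbT.
    have -> : [ffun x => ext c (f x)] == c.
      by apply/eqP/ffunP=> x; rewrite ffunE extf.
    by rewrite andbT; apply: eq_in_all_colored => e _; apply: extf.
  rewrite bracket_map (eq_in_bracket _ _ _ (c' := c)); last first.
    by move=> e _; apply: extf.
  apply: eq_bracket => k; rewrite ins_map curves_map //.
  by apply/withinP=> x y _; rewrite !full.
move=> c /andP[/forallP sc _]; apply/ffunP=> y; rewrite ffunE.
case: pickP => [x /eqP<-|yf]; first by rewrite ffunE.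
move: (sc y); case/orP=> [|/eqP//]; rewrite ins_map => /mapP[x _ yx].
by move: (yf x); rewrite yx eqxx.
Qed.

End StateSum.

Section Comparison.

Local Open Scope ring_scope.

Lemma variables_neq0 : [/\ var_a != 0, var_b != 0 & var_v != 0].
Proof. by split; rewrite tofrac_eq0 -mpoly.msupp_eq0 mpoly.msuppX. Qed.

(** Every edge of a diagram is incoming somewhere, so the support condition is void whatever [c0]
    is, and the power of the writhe unit splits into one factor per node. *)
Lemma permutation_jones_statesum (n : nat) (sigma : {perm 'I_n}) (c0 : 'I_n)
    (D : diagram) :
  permutation_jones sigma D =
  statesum sigma var_a var_b var_v c0
    [seq node_at x | x <- enum (vertex D)].
Proof.
have [a0 b0 _] := variables_neq0; set l := [seq _ | _ <- _].
have full (e : edge D) : e \in ins l.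
  by rewrite /ins -map_comp (perm_mem (edge_ends D)) mem_enum.
apply: eq_big => [c|c _].
  have -> : supported c0 (ins l) c by apply/forallP=> x; rewrite full.
  apply/forallP/allP=> [cc _ /mapP[x _ ->]|cc x].
    by move: (cc x); case: (node_at x).
  have /cc : node_at x \in l by rewrite map_f ?mem_enum.
  by case: (node_at x).
rewrite -bracket_states ?enum_uniq // big_distrr /=.
have mE : [set i in enum (vertex D) | mono c (node_at i)] = monochromatic c.
  by apply/setP=> x; rewrite !inE mem_enum; case: (node_at x) => // -[].
rewrite mE; apply: eq_bigr => s _.
rewrite mulrA; congr (_ * _ ^+ _).
  rewrite /writhe -sumrN prodr_exprz ?writhe_unit_neq0 //.
  rewrite -big_split big_enum /=; apply: eq_bigr => x _.
  have -> : vertex_factor c s x = (if mono c (node_at x) then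
      if x \in s then var_a else var_b else var_v) ^ sign (node_at x).
    by rewrite /vertex_factor -mE inE mem_enum.
  case E: (node_at x) => [k p q|i o] /=; last by rewrite !expr0z mulr1.
  by rewrite /weight; do 2?case: ifP => _; rewrite /= expfzMl mulrC exprz_inv.
rewrite /closed_curves; set k := flatten _; set k' := flatten _.
have -> : k = k'.
  congr flatten; apply: eq_map => x; rewrite /state_links -mE inE mem_enum /=.
  by case E: (node_at x) => [k0 p q|i o] //=; do 2?case: ifP.
by apply: eq_n_comp_r => x; rewrite !inE full.
Qed.

End Comparison.

(** * Eliminating inner labels *)

(* For deciding equality of states, the labels of a disc are numbered and the
   inner ones eliminated by computation: eliminate y k merges y with a neighbor,
   or, if there is none, counts the closed curve through y. *)
Definition neighbors (y : nat) (k : seq (nat * nat)) : seq nat :=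
  [seq q.2 | q <- k ++ [seq (p.2, p.1) | p <- k] & (q.1 == y) && (q.2 != y)].

Definition eliminate (y : nat) (k : seq (nat * nat)) : nat * seq (nat * nat) :=
  if neighbors y k is x :: _ then (0, map (map_link (rename y x)) k)
  else (1, [seq p <- k | p != (y, y)]).

Definition orient (p : nat * nat) : nat * nat := (minn p.1 p.2, maxn p.1 p.2).

Definition link_le (p q : nat * nat) : bool :=
  (p.1 < q.1) || ((p.1 == q.1) && (p.2 <= q.2)).

(** A canonical form, meant to make equal states syntactically equal after computation. Self-links
    may go because the label itself is still counted as an element of [V]. *)
Definition normal (k : seq (nat * nat)) : seq (nat * nat) :=
  sort link_le (map orient [seq p <- k | p.1 != p.2]).

Fixpoint reduce (I : seq nat) (k : seq (nat * nat)) : nat * seq (nat * nat) :=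
  if I is y :: I' then
    let t := eliminate y k in let t' := reduce I' t.2 in (t.1 + t'.1, t'.2)
  else (0, normal k).

Lemma mem_neighbors y k x : (x \in neighbors y k) = adj k y x && (x != y).
Proof.
apply/mapP/andP => [[[u w]]|[kyx xy]].
  rewrite mem_filter mem_cat /= => /andP[/andP[/eqP-> wy] kuw] ->; split=> //.
  case/orP: kuw => [kyw|/mapP[[w' y'] kwy [-> ->]]]; rewrite /adj /=.
    by rewrite kyw.
  by rewrite kwy orbT.
exists (y, x) => //; rewrite mem_filter mem_cat /= eqxx xy /=.
case/orP: kyx => [-> //|kxy]; apply/orP; right.
by apply/mapP; exists (x, y).
Qed.

Lemma normal_adj k x y : adj (normal k) x y = adj k x y && (x != y).
Proof.
have mn u w : ((u, w) \in normal k) = (u < w) && adj k u w.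
  rewrite mem_sort; apply/mapP/andP => [[[s t]]|[uw]].
    rewrite mem_filter /= => /andP[st kst].
    rewrite /orient /adj /= => -[-> ->].
    by rewrite /minn /maxn; case: (ltngtP s t) st => //= -> _; rewrite kst ?orbT.
  case/orP=> kuw; [exists (u, w)|exists (w, u)]; rewrite ?mem_filter ?kuw /= ?andbT.
  - by rewrite ltn_eqF.
  - by rewrite /orient /= (minn_idPl (ltnW uw)) (maxn_idPr (ltnW uw)).
  - by rewrite gtn_eqF.
  by rewrite /orient /= (minn_idPr (ltnW uw)) (maxn_idPl (ltnW uw)).
rewrite {1}/adj /= !mn.
have -> : adj k y x = adj k x y by rewrite /adj /= orbC.
by case: ltngtP; rewrite ?andbT ?andbF ?orbF.
Qed.

Section Reduce.
Variables (T : finType) (rho : nat -> T).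

Local Notation rho_ := (map (map_link rho)).

(** [rho] may identify outer labels, but the image of [y] lies outside [V]. So the neighbors
    computed on numerals are the true ones, and the outside links [m] never meet [y]. *)
Lemma curves_eliminate (V : seq T) y k m :
  rho y \notin V -> within V m ->
  (forall u w, adj k u w -> u != y -> rho u \in V) ->
  curves (rho y :: V) (rho_ k ++ m) =
  (eliminate y k).1 + curves V (rho_ (eliminate y k).2 ++ m).
Proof.
move=> yV mV kV.
have kV2 u w : adj k u w -> [/\ u != y -> rho u \in V & w != y -> rho w \in V].
  by move=> kuw; split; [apply: kV kuw | apply: (kV _ u); rewrite /adj /= orbC].
have rhoI u w : adj k u w -> (rho u == rho y) = (u == y).
  move=> /kV uV; case: (u =P y) => [->|/eqP /uV ruV]; first by rewrite eqxx.
  by apply: contraNF yV => /eqP <-.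
have kmV : within (rho y :: V) (rho_ k ++ m).
  apply/withinP=> u w; rewrite adj_cat => /orP[/adj_map[s [t [kst -> ->]]]|].
    rewrite !inE; case: (kV2 _ _ kst) => sV tV.
    split; first by case: (eqVneq s y) sV => [->|_ ->]; rewrite ?eqxx ?orbT.
    by case: (eqVneq t y) tV => [->|_ ->]; rewrite ?eqxx ?orbT.
  by case/(withinP _ _ mV) => uV wV; rewrite !inE uV wV !orbT.
rewrite /eliminate; case E: (neighbors y k) => [|x s] /=; last first.
  have : x \in neighbors y k by rewrite E mem_head.
  rewrite mem_neighbors => /andP[kyx xy].
  have xV : rho x \in V by case: (kV2 _ _ kyx) => _; apply.
  rewrite (curves_contract yV xV _ kmV); last first.
    by rewrite adj_cat; apply/orP; left; apply/adj_map; exists y, x.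
  have -> : map (map_link (rename (rho y) (rho x))) (rho_ k ++ m) =
            rho_ (map (map_link (rename y x)) k) ++ m; last by rewrite add0n.
  rewrite map_cat -!map_comp.
  have -> : map (map_link (rename (rho y) (rho x))) m = m.
    rewrite -[RHS]map_id; apply/eq_in_map => -[u w] /(allP mV) /= /andP[uV wV].
    rewrite /map_link /rename /= !ifN //.
      by apply: contraNneq yV => <-.
    by apply: contraNneq yV => <-.
  congr cat; apply/eq_in_map => -[u w] kuw.
  have kuw' : adj k u w by rewrite /adj /= kuw.
  have kwu : adj k w u by rewrite /adj /= kuw orbT.
  rewrite /= /map_link /rename /= (rhoI _ _ kuw') (rhoI _ _ kwu).
  by congr (_, _); case: ifP.
rewrite add1n curves_isolated //; last first.
  move=> z; rewrite adj_cat => /orP[/adj_map[u [w [kuw yu ->]]]|].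
    have uy : u = y by apply/eqP; rewrite -(rhoI _ _ kuw) yu.
    case: (eqVneq w y) => [-> //|wy].
    have : w \in neighbors y k by rewrite mem_neighbors -uy kuw uy wy.
    by rewrite E.
  by case/(withinP _ _ mV) => yV'; rewrite yV' in yV.
congr (curves V _).+1; rewrite filter_cat filter_map; congr (map _ _ ++ _).
  apply: eq_in_filter => -[u w] kuw /=; rewrite /map_link !xpair_eqE /=.
  have kuw' : adj k u w by rewrite /adj /= kuw.
  have kwu : adj k w u by rewrite /adj /= kuw orbT.
  by rewrite (rhoI _ _ kuw') (rhoI _ _ kwu).
apply/all_filterP; apply: sub_all mV => -[u w] /= /andP[uV _].
by rewrite xpair_eqE negb_and; apply/orP; left; apply: contraNneq yV => <-.
Qed.

Lemma eliminate_adj y k u w : adj (eliminate y k).2 u w ->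
  u != y /\ exists t, adj k u t.
Proof.
rewrite /eliminate; case E: (neighbors y k) => [|x s] /=.
  rewrite /adj /= !mem_filter => kuw.
  have kuw' : adj k u w by rewrite /adj /=; case/orP: kuw => /andP[_ ->]; rewrite ?orbT.
  split; last by exists w.
  have : (u, w) != (y, y) by case/orP: kuw => /andP[]; rewrite !xpair_eqE // andbC.
  apply: contraNneq => uy; rewrite xpair_eqE uy eqxx /=.
  apply/eqP; have : w \notin neighbors y k by rewrite E.
  by rewrite mem_neighbors -{1}uy kuw' /= negbK => /eqP.
have : x \in neighbors y k by rewrite E mem_head.
rewrite mem_neighbors => /andP[kyx xy] /adj_map[s' [t [kst -> _]]].
rewrite /rename; case: (eqVneq s' y) => [_|s'y]; split=> //; last by exists t.
by exists y; rewrite /adj /= orbC.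
Qed.

Lemma curves_reduce (V : seq T) I k m :
  uniq (map rho I) -> all (fun y => rho y \notin V) I -> within V m ->
  (forall u w, adj k u w -> u \notin I -> rho u \in V) ->
  curves (map rho I ++ V) (rho_ k ++ m) =
  (reduce I k).1 + curves V (rho_ (reduce I k).2 ++ m).
Proof.
elim: I k => [|y I IHI] k /=.
  move=> _ _ _ _; rewrite add0n /curves.
  suff ek : connect (adj (rho_ k ++ m)) =2 connect (adj (rho_ (normal k) ++ m)).
    exact: eq_n_comp.
  move=> s t; apply/idP/idP; apply: connect_sub => {s t} s t;
    rewrite adj_cat => /orP[/adj_map[u [w [kuw -> ->]]]|mst];
    try by apply: connect1; rewrite adj_cat mst orbT.
    case: (eqVneq u w) => [->|uw]; first exact: connect0.
    apply: connect1; rewrite adj_cat; apply/orP; left; apply/adj_map.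
    by exists u, w; rewrite normal_adj kuw.
  apply: connect1; rewrite adj_cat; apply/orP; left; apply/adj_map.
  by exists u, w; move: kuw; rewrite normal_adj => /andP[].
case/andP=> yI uI /andP[yV IV] mV kV.
rewrite curves_eliminate.
- rewrite IHI ?addnA // => u w /eliminate_adj[uy [t kut]] uI'.
  by apply: kV kut _; rewrite inE negb_or uy.
- by rewrite mem_cat negb_or yI.
- by apply: sub_within mV => x xV; rewrite mem_cat xV orbT.
move=> u w kuw uy; rewrite mem_cat; case: (boolP (u \in I)) => uI'.
  by rewrite map_f.
by rewrite (kV _ _ kuw) ?orbT // inE negb_or uy.
Qed.

End Reduce.

(** * Crossings in the reference picture *)

Lemma map_cross (E E' : Type) (f : E -> E') l d r r' s t :
  map_node f (cross l d r r' s t) = cross l d r r' (map_link f s) (map_link f t).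
Proof. by case: l d r r' => [] [] [] []. Qed.

Section Cross.
Variables (n : nat) (sigma : {perm 'I_n}) (F : fieldType) (a b v : F).

Local Open Scope ring_scope.

Local Notation weight := (weight a b).
Local Notation bracket := (bracket a b v).
Local Notation colored := (colored sigma).

(* The change of the color along a strand followed upward in the reference
   picture of cross; at a crossing with flags d, r, r' it does not depend on the
   orientation of the strand itself, only on that of the other strand. *)
Definition turn (l : level) (d : bool) : {perm 'I_n} :=
  if l is Virtually then 1%g else if d then sigma^-1%g else sigma.

(** Each turn is a power of [sigma]. This is why both sides of move III impose the same condition on
    the boundary colors. *)
Lemma turnC l l' d d' x : turn l d (turn l' d' x) = turn l' d' (turn l d x).
Proof. by case: l l' d d' => [] [] [] []; rewrite /= ?perm1 ?permK ?permKV. Qed.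

(* Monochromaticity of a classical crossing in terms of the colors x and y of
   the lower edges of the two strands in the reference picture. *)
Definition matching (d r r' : bool) (x y : 'I_n) : bool :=
  if r == r' then if d (+) r then x == sigma y else y == sigma x else x == y.

Definition cross_sign (l : level) (d r r' : bool) : int :=
  match l with
  | Above => if d (+) r (+) r' then 1 else -1
  | Below => if d (+) r (+) r' then -1 else 1
  | Virtually => 0
  end.

(* The coefficients of the vertical smoothing, the horizontal smoothing and the
   virtual crossing, as seen in the reference picture. *)
Definition coefV l d r r' x y : F :=
  if (if l is Virtually then false else matching d r r' x y) then
    weight (if r == r' then a else b) (cross_sign l d r r')
  else 0.

Definition coefH l d r r' x y : F :=
  if (if l is Virtually then false else matching d r r' x y) then
    weight (if r == r' then b else a) (cross_sign l d r r')
  else 0.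

Definition coefX l d r r' x y : F :=
  if (if l is Virtually then false else matching d r r' x y) then 0
  else weight v (cross_sign l d r r').

Lemma eq_permV (x y : 'I_n) : (x == sigma^-1%g y) = (y == sigma x).
Proof. by apply/eqP/eqP => ->; rewrite ?permK ?permKV. Qed.

Lemma colored_cross (E : eqType) (c : E -> 'I_n) l d r r' s t :
  colored c (cross l d r r' s t) =
  (c s.2 == turn l (d (+) r') (c s.1)) && (c t.2 == turn l (~~ (d (+) r)) (c t.1)).
Proof.
case: l d r r' => [] [] [] [] /=; apply/andP/andP => -[/eqP-> /eqP->];
  by rewrite ?perm1 ?permK ?permKV ?eqxx.
Qed.

(** Depending on the orientations, the quadrant compared by [mono] is the left, right, lower or
    upper one of the reference picture; the coloring rule expresses its upper edges through the
    lower ones. *)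
Lemma mono_cross (E : eqType) (c : E -> 'I_n) l d r r' s t :
  colored c (cross l d r r' s t) ->
  mono c (cross l d r r' s t) =
  (if l is Virtually then false else matching d r r' (c s.1) (c t.1)).
Proof.
rewrite colored_cross => /andP[/eqP es /eqP et].
case: l d r r' es et => [] [] [] [] /= es et //=; rewrite /matching /= ?es ?et //.
all: rewrite ?(inj_eq perm_inj) //.
all: rewrite eq_sym ?eq_permV ?(inj_eq perm_inj) //.
Qed.

Definition joins (E : eqType) (x y : E) (p : E * E) : bool :=
  ((x, y) == p) || ((y, x) == p).

Lemma adj_joins (E : eqType) (k : seq (E * E)) x y : adj k x y = has (joins x y) k.
Proof.
elim: k => //= p k <-; rewrite /adj /= !inE /joins -!orbA; congr (_ || _).
by rewrite orbCA.
Qed.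

Lemma joins_swap (E : eqType) (x y u w : E) : joins x y (u, w) = joins x y (w, u).
Proof. by rewrite /joins orbC !xpair_eqE ![(y == _) && _]andbC. Qed.

Ltac flip_links flip t1 t2 s1 s2 :=
  apply: flip => ? ?; rewrite !adj_joins /=
    ?(joins_swap _ _ t2 s1) ?(joins_swap _ _ s2 t1) ?(joins_swap _ _ t1 s1)
    ?(joins_swap _ _ t2 s2) ?(joins_swap _ _ s2 s1) ?(joins_swap _ _ t2 t1);
  by do 2?case: joins.

(** The smoothing compatible with the orientation is vertical for parallel strands and horizontal
    for antiparallel ones, which explains the exchange of [a] and [b] in the coefficients. *)
Lemma bracket_cross (E : eqType) (c : E -> 'I_n) l d r r' s t nodes K :
  link_invariant K ->
  colored c (cross l d r r' s t) ->
  bracket c (cross l d r r' s t :: nodes) K =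
    coefV l d r r' (c s.1) (c t.1) *
      bracket c nodes (fun k => K ([:: (s.1, t.2); (t.1, s.2)] ++ k)) +
    coefH l d r r' (c s.1) (c t.1) *
      bracket c nodes (fun k => K ([:: (s.1, t.1); (s.2, t.2)] ++ k)) +
    coefX l d r r' (c s.1) (c t.1) *
      bracket c nodes (fun k => K ([:: (s.1, s.2); (t.1, t.2)] ++ k)).
Proof.
move=> Kadj ct; have mc := mono_cross ct; move: mc {ct}.
have flip p q p' q' : adj [:: p; q] =2 adj [:: p'; q'] ->
    bracket c nodes (fun k => K [:: p, q & k]) =
    bracket c nodes (fun k => K [:: p', q' & k]).
  move=> pq; apply: eq_bracket => m; apply: Kadj => x y.
  by rewrite -[_ :: _]/([:: p; q] ++ m) adj_cat pq -adj_cat.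
rewrite /coefV /coefH /coefX; case: s t => s1 s2 [t1 t2] /=.
move: (matching d r r' (c s1) (c t1)) => mt.
case: l d r r' => [] [] [] [] /= mc; rewrite /smoothings /smoothing /mono /= ?mc /=;
  try case: mt mc => mc; rewrite ?big_cons big_nil ?mul0r ?add0r ?addr0 //=;
  try (first [congr (_ * _ + _ * _) | congr (_ * _)];
       flip_links flip t1 t2 s1 s2);
  by rewrite [LHS]addrC; congr (_ * _ + _ * _); flip_links flip t1 t2 s1 s2.
Qed.

End Cross.

(** * Coefficients of the crossings in move III *)

Section Coef.
Variables (n : nat) (sigma : {perm 'I_n}) (F : fieldType) (a b v : F).
Hypotheses (a0 : a != 0%R) (b0 : b != 0%R) (v0 : v != 0%R).
Local Open Scope ring_scope.

Local Notation circle := (circle a b).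
Local Notation weight := (weight a b).
Local Notation turn := (turn sigma).
Local Notation matching := (matching sigma).
Local Notation coefV := (coefV sigma a b).
Local Notation coefH := (coefH sigma a b).
Local Notation coefX := (coefX sigma a b v).

(* Up to the common factor coefV, a monochromatic crossing is a crossing of the
   unoriented Kauffman bracket. *)
Definition ratio (l : level) (d : bool) : F :=
  match l with
  | Above => if d then b / a else a / b
  | Below => if d then a / b else b / a
  | Virtually => 0
  end.

(** Passing from parallel to antiparallel strands exchanges [a] and [b] and also changes the sign;
    both invert the quotient, so it is independent of the orientations. The writhe units cancel. *)
Lemma coefH_ratio l d r r' x y :
  coefH l d r r' x y = ratio l d * coefV l d r r' x y.
Proof.
rewrite /coefH /coefV; case: l; last by rewrite mulr0.
all: case: matching; last by rewrite mulr0.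
all: case: d r r' => [] [] [] /=; rewrite /weight ?expr1z ?exprN1; field.
all: by rewrite ?writhe_unit_neq0 ?a0 ?b0.
Qed.

Lemma coef_matching l d r r' x y x' y' :
  l = Virtually \/ matching d r r' x y = matching d r r' x' y' ->
  [/\ coefV l d r r' x y = coefV l d r r' x' y',
      coefH l d r r' x y = coefH l d r r' x' y' &
      coefX l d r r' x y = coefX l d r r' x' y'].
Proof. by rewrite /coefV /coefH /coefX => -[->|->]. Qed.

Lemma coef_unmatched l d r r' x y : l = Virtually \/ ~~ matching d r r' x y ->
  coefV l d r r' x y = 0 /\ coefH l d r r' x y = 0.
Proof.
rewrite /coefV /coefH => -[->|/negPf->] //.
by case: l.
Qed.

Lemma coef_matched l d r r' x y : l <> Virtually -> matching d r r' x y ->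
  coefX l d r r' x y = 0.
Proof. by rewrite /coefX; case: l => // _ ->. Qed.

(** The matching condition separates into one key per strand, each depending only on the orientation
    and lower color of that strand. This is the source of transitivity. *)
Definition left_key (r : bool) (x : 'I_n) := if r then sigma x else x.
Definition right_key (r : bool) (x : 'I_n) := if r then x else sigma x.

Lemma matchingE r r' x y :
  matching true r r' x y = (left_key r x == right_key r' y).
Proof.
by case: r r' => [] []; rewrite /matching //= ?(inj_eq perm_inj) // eq_sym.
Qed.

(** When two strands pass a third one in the same direction, both colors change by the same power of
    [sigma]. *)
Lemma matching_turn d r r' l e x y :
  matching d r r' (turn l e x) (turn l e y) = matching d r r' x y.
Proof.
have tS z : sigma (turn l e z) = turn l e (sigma z).
  by rewrite -[sigma]/(turn Below false) turnC.
by rewrite /matching !tS !(inj_eq perm_inj).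
Qed.

Lemma turnN l l' e x : l <> Virtually -> l' <> Virtually ->
  turn l (~~ e) (turn l' e x) = x.
Proof. by case: l l' e => [] [] [] //= _ _; rewrite ?permK ?permKV. Qed.

Lemma turn_classical l l' e : l <> Virtually -> l' <> Virtually ->
  turn l e = turn l' e.
Proof. by case: l l' => [] []. Qed.

Section Triangle.
Variables (lAB lAC lBC : level) (rA rB rC : bool) (x y z : 'I_n).
(* yA is the color of strand B after it has crossed strand A only, etc. *)
Let yA := turn lAB rA y.
Let zA := turn lAC rA z.
Let xB := turn lAB (~~ rB) x.
Let zB := turn lBC rB z.
Let xC := turn lAC (~~ rC) x.
Let yC := turn lBC (~~ rC) y.
Let mAB := matching true rA rB x y.
Let mAC := matching true rA rC xB z.
Let mBC := matching true rB rC yA zA.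

Lemma triangle_coefs : triangle_levels lAB lAC lBC ->
  [/\ [/\ coefV lAB true rA rB x y = coefV lAB true rA rB xC yC,
          coefH lAB true rA rB x y = coefH lAB true rA rB xC yC &
          coefX lAB true rA rB x y = coefX lAB true rA rB xC yC],
      [/\ coefV lAC true rA rC xB z = coefV lAC true rA rC x zB,
          coefH lAC true rA rC xB z = coefH lAC true rA rC x zB &
          coefX lAC true rA rC xB z = coefX lAC true rA rC x zB] &
      [/\ coefV lBC true rB rC yA zA = coefV lBC true rB rC y z,
          coefH lBC true rB rC yA zA = coefH lBC true rB rC y z &
          coefX lBC true rB rC yA zA = coefX lBC true rB rC y z]].
Proof.
move=> tri.
(* Either all crossings are classical, or each crossing is virtual itself or has strands that meet
   the third strand only virtually and keep their colors. *)
have E : [/\ lAB <> Virtually, lAC <> Virtually & lBC <> Virtually] \/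
  [/\ lAB = Virtually \/ lAC = Virtually /\ lBC = Virtually,
      lAC = Virtually \/ lAB = Virtually /\ lBC = Virtually &
      lBC = Virtually \/ lAB = Virtually /\ lAC = Virtually].
  case: tri => [hA hB hC _|||| ]; try by move=> *; right; split; tauto.
  by left; rewrite /height_level; split; case: ifP.
case: E => [[cAB cAC cBC]|[vAB vAC vBC]]; split; apply: coef_matching.
- by right; rewrite /xC /yC (turn_classical _ cAC cBC) matching_turn.
(* A and C pass B in opposite directions. Applying to both colors the turn of C across B undoes the
   turn of A and produces [zB]. *)
- right; rewrite -(matching_turn _ _ _ lBC rB) /xB /zB.
  by rewrite -{1}[rB]negbK turnN.
- by right; rewrite /yA /zA (turn_classical _ cAB cAC) matching_turn.
- by case: vAB => [->|[eAC eBC]]; [left | right; rewrite /xC /yC eAC eBC /= !perm1].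
- by case: vAC => [->|[eAB eBC]]; [left | right; rewrite /xB /zB eAB eBC /= !perm1].
by case: vBC => [->|[eAB eAC]]; [left | right; rewrite /yA /zA eAB eAC /= !perm1].
Qed.

(** Each ratio is t or 1/t with t = a/b, and [circle] is - t - 1/t. If q1 q3 = 1 the identity is
    immediate; if q1 = q3 it holds for q2 equal to them, and the remaining value of q2 would mean
    cyclic heights. *)
Lemma ratio_triangle (hA hB hC : nat) : uniq [:: hA; hB; hC] ->
  let q1 := ratio (height_level hA hB) true in
  let q2 := ratio (height_level hA hC) true in
  let q3 := ratio (height_level hB hC) true in
  q1 + q3 + q1 * q3 * (circle + q2) = q2.
Proof.
rewrite /= !inE negb_or andbT => /andP[/andP[AB AC] BC].
rewrite /height_level /ratio /circle.
case: (ltngtP hB hA) AB => // AB _; case: (ltngtP hC hA) AC => // AC _;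
  case: (ltngtP hC hB) BC => // BC _; try (by field; rewrite ?a0 ?b0).
  by have := ltn_trans BC AB; rewrite ltnNge ltnW.
by have := ltn_trans AB BC; rewrite ltnNge ltnW.
Qed.

(* Matching is transitive along the triangle, so it cannot occur at exactly two
   of the three crossings. *)
Lemma triangle_matching : lAB <> Virtually -> lAC <> Virtually ->
  lBC <> Virtually ->
  [\/ [/\ mAB, mAC & mBC], ~~ mAB /\ ~~ mAC, ~~ mAB /\ ~~ mBC | ~~ mAC /\ ~~ mBC].
Proof.
move=> cAB cAC cBC; rewrite /mAB /mAC /mBC /yA /zA.
rewrite (turn_classical _ cAB cAC) matching_turn !matchingE.
(* Read after A has passed B, the three conditions become p = q, p = s and q = s for the keys named
   below. *)
have -> : (left_key rA x == right_key rB y) = (left_key rA xB == left_key rB y).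
  rewrite /xB; case: lAB cAB rA rB => [] // _ [] [] /=;
    by rewrite ?permKV ?(inj_eq perm_inj) // [RHS]eq_sym eq_permV.
set p := left_key rA _; set q := left_key rB _; set s := right_key rC _.
case: (eqVneq p q) => [->|pq]; first by case: (q == s); constructor.
case: (eqVneq p s) => [<-|ps]; last by constructor.
by rewrite eq_sym pq; constructor.
Qed.

(** The identity in the first case is [ratio_triangle] multiplied by V1 V2 V3. In the other cases
    two crossings act as multiples of virtual ones. *)
Lemma triangle_cases : triangle_levels lAB lAC lBC ->
  let V1 := coefV lAB true rA rB x y in let H1 := coefH lAB true rA rB x y in
  let V2 := coefV lAC true rA rC xB z in let H2 := coefH lAC true rA rC xB z in
  let V3 := coefV lBC true rB rC yA zA in let H3 := coefH lBC true rB rC yA zA in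
  let X1 := coefX lAB true rA rB x y in let X2 := coefX lAC true rA rC xB z in
  let X3 := coefX lBC true rB rC yA zA in
  [\/ [/\ X1 = 0, X2 = 0, X3 = 0 &
        H1 * V2 * V3 + V1 * V2 * H3 + H1 * V2 * H3 * circle + H1 * H2 * H3
        = V1 * H2 * V3],
      [/\ V1 = 0, H1 = 0, V2 = 0 & H2 = 0],
      [/\ V1 = 0, H1 = 0, V3 = 0 & H3 = 0] |
      [/\ V2 = 0, H2 = 0, V3 = 0 & H3 = 0]].
Proof.
move=> tri V1 H1 V2 H2 V3 H3 X1 X2 X3.
have two l d r r' u w l' e s s' u' w' :
    l = Virtually \/ ~~ matching d r r' u w ->
    l' = Virtually \/ ~~ matching e s s' u' w' ->
    [/\ coefV l d r r' u w = 0, coefH l d r r' u w = 0,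
        coefV l' e s s' u' w' = 0 & coefH l' e s s' u' w' = 0].
  by move=> /coef_unmatched[-> ->] /coef_unmatched[-> ->].
have : [\/ [/\ [/\ mAB, mAC & mBC], [/\ lAB <> Virtually, lAC <> Virtually & lBC <> Virtually] &
     let q1 := ratio lAB true in let q2 := ratio lAC true in
     let q3 := ratio lBC true in q1 + q3 + q1 * q3 * (circle + q2) = q2],
   (lAB = Virtually \/ ~~ mAB) /\ (lAC = Virtually \/ ~~ mAC),
   (lAB = Virtually \/ ~~ mAB) /\ (lBC = Virtually \/ ~~ mBC) |
   (lAC = Virtually \/ ~~ mAC) /\ (lBC = Virtually \/ ~~ mBC)].
  move: (@triangle_matching); case: tri => [hA hB hC uABC|||| ];
    try by move=> *; first [by constructor; split; left].
  have cl h h' : height_level h h' <> Virtually by rewrite /height_level; case: ifP.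
  move=> /(_ (cl _ _) (cl _ _) (cl _ _)) [m|[m m']|[m m']|[m m']].
  - by constructor 1; split=> //; apply: ratio_triangle.
  - by constructor 2; split; right.
  - by constructor 3; split; right.
  - by constructor 4; split; right.
case=> [[[m1 m2 m3] [c1 c2 c3] q]|[]|[]|[]].
- constructor 1; split; try exact: coef_matched.
  rewrite /H1 /H2 /H3 !coefH_ratio -/V1 -/V2 -/V3 -{2}q /=; ring.
- by move=> m m'; constructor 2; apply: two.
- by move=> m m'; constructor 3; apply: two.
- by move=> m m'; constructor 4; apply: two.
Qed.

End Triangle.

End Coef.

(** * The moves inside a disc *)

Section Local.
Variables (n : nat) (sigma : {perm 'I_n}) (F : fieldType) (a b v : F).
Hypotheses (a0 : a != 0%R) (b0 : b != 0%R) (v0 : v != 0%R).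
Local Open Scope ring_scope.

Local Notation circle := (circle a b).
Local Notation weight := (weight a b).
Local Notation bracket := (bracket a b v).
Local Notation colored := (colored sigma).
Local Notation turn := (turn sigma).
Local Notation matching := (matching sigma).
Local Notation coefV := (coefV sigma a b).
Local Notation coefH := (coefH sigma a b).
Local Notation coefX := (coefX sigma a b v).

Definition update (I : seq nat) (vs : (nat -> 'I_n) -> seq 'I_n)
    (g : nat -> 'I_n) (i : nat) : 'I_n := nth (g i) (vs g) (index i I).

(* I lists the labels inside the disc of a local picture L; in a coloring of L
   their colors are the functions vs of the colors of the labels ext. *)
Record extension (L : seq (node nat)) (I ext : seq nat)
    (vs : (nat -> 'I_n) -> seq 'I_n) : Prop := Extension {
  ext_uniq : uniq I;
  ext_labels : {in ext, forall i, (i \in labels L) && (i \notin I)};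
  ext_size g : size (vs g) = size I;
  ext_eq g g' : {in ext, g =1 g'} -> vs g = vs g';
  ext_val g : all (colored g) L -> vs g = map g I
}.

(** [K'] is the closure as seen from the boundary, shared by both sides of a move; [curves_reduce]
    later supplies this relation for actual diagrams. *)
Definition reduces (L : seq (node nat)) (I : seq nat)
    (K K' : seq (nat * nat) -> F) : Prop :=
  forall k, within (labels L) k ->
    K k = circle ^+ (reduce I k).1 * K' (reduce I k).2.

(* Two pictures of the same disc, with edges numbered, which have equal state sums
   for every coloring and every way K of closing them up outside of the disc. *)
Record locally_equivalent (L R : seq (node nat)) (I I' ext ext' : seq nat)
    (vs vs' : (nat -> 'I_n) -> seq 'I_n) : Prop := LocallyEquivalent {
  loc_left : extension L I ext vs;
  loc_right : extension R I' ext' vs';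
  loc_in : {subset I <= ins L};
  loc_out : {subset I <= outs L};
  loc_ins : ins R =i I' ++ [seq i <- ins L | i \notin I];
  loc_inner : {subset I' <= I};
  loc_labels :
    {in labels R, forall i, (i \in I') || (i \in labels L) && (i \notin I)};
  loc_colored g :
    all (colored (update I vs g)) L = all (colored (update I' vs' g)) R;
  loc_bracket g K K1 K2 : all (colored (update I vs g)) L ->
    link_invariant K1 -> link_invariant K2 ->
    reduces L I K1 K -> reduces R I' K2 K ->
    bracket (update I vs g) L K1 = bracket (update I' vs' g) R K2
}.

Lemma reduces_sub L I K K' V : {subset V <= labels L} -> reduces L I K K' ->
  forall k, within V k -> K k = circle ^+ (reduce I k).1 * K' (reduce I k).2.
Proof. by move=> sV r k kV; apply/r/(sub_within sV). Qed.

Ltac reduce_links h K I :=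
  repeat match goal with
  | |- context [K ?l] => rewrite (h l isT);
    let r := eval vm_compute in (reduce I l) in
    change (reduce I l) with r; cbn [fst snd]
  end.

Lemma reidemeister3_local lAB lAC lBC rA rB rC :
  triangle_levels lAB lAC lBC ->
  locally_equivalent
    [:: cross lAB true rA rB (0, 1) (3, 4);
        cross lAC true rA rC (1, 2) (6, 7);
        cross lBC true rB rC (4, 5) (7, 8)]%N
    [:: cross lBC true rB rC (3, 4) (6, 7);
        cross lAC true rA rC (0, 1) (7, 8);
        cross lAB true rA rB (1, 2) (4, 5)]%N
    [:: 1; 4; 7]%N [:: 1; 4; 7]%N [:: 0; 3; 6]%N [:: 0; 3; 6]%N
    (fun g => [:: turn lAB (~~ rB) (g 0%N); turn lAB rA (g 3%N); turn lAC rA (g 6%N)])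
    (fun g => [:: turn lAC (~~ rC) (g 0%N); turn lBC (~~ rC) (g 3%N);
                  turn lBC rB (g 6%N)]).
Proof.
move=> tri; set L := [:: _; _; _]; set R := [:: _; _; _].
set I := [:: _; _; _]; set vs := fun g => [:: turn lAB _ _; _; _].
set vs' := fun g => [:: turn lAC _ _; _; _].
have labL : {subset iota 0 9 <= labels L}.
  by apply/allP; case: rA rB rC @L @R @vs @vs' => [] [] [].
have labR : {subset iota 0 9 <= labels R}.
  by apply/allP; case: rA rB rC @L @R @vs @vs' {labL} => [] [] [].
have colE g : all (colored (update I vs g)) L = all (colored (update I vs' g)) R.
  rewrite /L /R /= !colored_cross /= !negbK /update /= !eqxx /=.
  rewrite (turnC _ lAC lAB) (turnC _ lBC lAB) (turnC _ lBC lAC) !andbT.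
  by do 3 case: (_ == _).
split=> //.
- split=> //.
  + by apply/allP; case: rA rB rC @L @R @vs @vs' {labL labR colE} => [] [] [].
  + by move=> g g' gg'; rewrite /vs !gg'.
  + move=> g /=; rewrite !colored_cross /= !negbK.
    by case/and4P=> /andP[/eqP-> /eqP->] /andP[_ /eqP->] _ _.
- split=> //.
  + by apply/allP; case: rA rB rC @L @R @vs @vs' {labL labR colE} => [] [] [].
  + by move=> g g' gg'; rewrite /vs' !gg'.
  + move=> g /=; rewrite !colored_cross /= !negbK.
    by case/and4P=> /andP[/eqP-> /eqP->] /andP[/eqP-> _] _ _.
- by apply/allP; case: rA rB rC @L @R @vs @vs' {labL labR colE} => [] [] [].
- by apply/allP; case: rA rB rC @L @R @vs @vs' {labL labR colE} => [] [] [].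
- by apply: perm_mem; case: rA rB rC @L @R @vs @vs' {labL labR colE} => [] [] [].
- by apply/allP; case: rA rB rC @L @R @vs @vs' {labL labR colE} => [] [] [].
move=> g K K1 K2 colL inv1 inv2 /(reduces_sub labL) h1 /(reduces_sub labR) h2.
have := colL; rewrite colE => /and4P[c4 c5 c6 _].
have /and4P[c1 c2 c3 _] := colL.
have expand := fun c l d r r' s t nodes K i e =>
  @bracket_cross n sigma F a b v nat c l d r r' s t nodes K e i.
rewrite (expand _ _ _ _ _ _ _ _ _ c1) // !(expand _ _ _ _ _ _ _ _ _ c2);
  try exact: link_invariant_cat.
rewrite !(expand _ _ _ _ _ _ _ _ _ c3); try exact: link_invariant_cat2.
rewrite (expand _ _ _ _ _ _ _ _ _ c4) // !(expand _ _ _ _ _ _ _ _ _ c5);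
  try exact: link_invariant_cat.
rewrite !(expand _ _ _ _ _ _ _ _ _ c6); try exact: link_invariant_cat2.
rewrite /= /update /=.
have [[<- <- <-] [<- <- <-] [<- <- <-]] :=
  triangle_coefs sigma a b v rA rB rC (g 0%N) (g 3%N) (g 6%N) tri.
have := triangle_cases sigma v a0 b0 rA rB rC (g 0%N) (g 3%N) (g 6%N) tri.
move=> /=.
move: (coefV lAB _ _ _ _ _) (coefH lAB _ _ _ _ _) (coefX lAB _ _ _ _ _) => V1 H1 X1.
move: (coefV lAC _ _ _ _ _) (coefH lAC _ _ _ _ _) (coefX lAC _ _ _ _ _) => V2 H2 X2.
move: (coefV lBC _ _ _ _ _) (coefH lBC _ _ _ _ _) (coefX lBC _ _ _ _ _) => V3 H3 X3.
(* Each state becomes a power of [circle] times [K] at a normalized pairing of the boundary labels,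
   so both sides are combinations of the same unknowns. *)
reduce_links h1 K1 I.
reduce_links h2 K2 I.
rewrite ?expr0 ?expr1 ?mul1r.
move: (K [:: (0, 3); (2, 6); (5, 8)]%N) (K [:: (0, 8); (2, 5); (3, 6)]%N) => Kl Kr.
repeat match goal with |- context [K ?l] => move: (K l) => ? end.
case=> [[-> -> -> e]|[-> -> -> ->]|[-> -> -> ->]|[-> -> -> ->]];
  [|ring|ring|ring].
(* Kl and Kr are the states in which the two left, respectively the two right,
   bottom ends are joined; all other states match. *)
apply/eqP; rewrite -subr_eq0; apply/eqP.
set S := (X in X = _) in e; transitivity ((S - V1 * H2 * V3) * (Kl - Kr)).
  by rewrite /S; ring.
by rewrite e subrr mul0r.
Qed.

Lemma matching_inverse l rA rB x y : l <> Virtually ->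
  matching false rA rB (turn l (~~ rB) x) (turn l rA y) = matching true rA rB x y.
Proof.
rewrite /matching; case: l => // _; case: rA rB => [] [] //=;
  by rewrite ?permK ?permKV ?(inj_eq perm_inj) // eq_permV.
Qed.

(** The two crossings of move II have opposite signs and are monochromatic together, so their
    weights are inverse. With q = H / V the last sum is 1/q + q + [circle], which vanishes since q
    is a/b or b/a. *)
Lemma coef_inverse l rA rB x y x' y' :
  x' = turn l (~~ rB) x -> y' = turn l rA y ->
  let V := coefV l true rA rB x y in let V' := coefV l false rA rB x' y' in
  let H := coefH l true rA rB x y in let H' := coefH l false rA rB x' y' in
  let X := coefX l true rA rB x y in let X' := coefX l false rA rB x' y' in
  [\/ [/\ X = 0, X' = 0, V * V' = 1, H * H' = 1 &
        V * H' + H * V' + H * H' * circle = 0] |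
      [/\ V = 0, H = 0, V' = 0, H' = 0 & X * X' = 1]].
Proof.
move=> ex ey.
rewrite /coefV /coefH /coefX; case: l ex ey => ex ey; last first.
  by right; rewrite /weight !expr0z mulr1.
all: rewrite ex ey matching_inverse //.
all: case: matching; [left|right]; split=> //; rewrite /cross_sign;
  case: rA rB {ex ey} => [] [] /=; rewrite /weight /circle ?expr1z ?exprN1; field.
all: by rewrite ?writhe_unit_neq0 ?a0 ?b0 ?v0.
Qed.

Lemma reidemeister2_local l rA rB :
  locally_equivalent
    [:: cross l true rA rB (0, 1) (3, 4);
        cross l false rA rB (1, 2) (4, 5)]%N
    [:: strand rA (0, 2); strand rB (3, 5)]%N
    [:: 1; 4]%N [::] [:: 0; 3]%N [::]
    (fun g => [:: turn l (~~ rB) (g 0%N); turn l rA (g 3%N)]) (fun=> [::]).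
Proof.
set L := [:: _; _]; set R := [:: _; _]; set I := [:: _; _].
set vs := fun g => [:: turn _ _ _; _].
have labL : {subset iota 0 6 <= labels L}.
  by apply/allP; case: rA rB @L @R @vs => [] [].
have labR : {subset [:: 0; 2; 3; 5]%N <= labels R}.
  by apply/allP; case: rA rB @L @R @vs {labL} => [] [].
have colE g : all (colored (update I vs g)) L =
              all (colored (update [::] (fun=> [::]) g)) R.
  rewrite /L /R /= !colored_cross /= !negbK /update /= !eqxx /=.
  have turnV z e : turn l (~~ e) (turn l e z) = z.
    by case: l e {L vs labL} => [] [] /=; rewrite ?perm1 ?permK ?permKV.
  rewrite turnV.
  have -> : turn l rB (turn l (~~ rB) (g 0%N)) = g 0%N.
    by rewrite -{1}[rB]negbK turnV.
  by case: rA rB {L R vs labL labR} => [] [];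
    rewrite /= !andbT ?[g 0%N == _]eq_sym ?[g 3%N == _]eq_sym.
split=> //.
- split=> //.
  + by apply/allP; case: rA rB @L @R @vs {labL labR colE} => [] [].
  + by move=> g g' gg'; rewrite /vs !gg'.
  + move=> g /=; rewrite !colored_cross /= !negbK.
    by case/and3P=> /andP[/eqP-> /eqP->].
- by apply/allP; case: rA rB @L @R @vs {labL labR colE} => [] [].
- by apply/allP; case: rA rB @L @R @vs {labL labR colE} => [] [].
- by apply: perm_mem; case: rA rB @L @R @vs {labL labR colE} => [] [].
- by apply/allP; case: rA rB @L @R @vs {labL labR colE} => [] [].
move=> g K K1 K2 colL inv1 inv2 /(reduces_sub labL) h1 /(reduces_sub labR) h2.
have /and3P[c1 c2 _] := colL.
have expand := fun c l d r r' s t nodes K i e =>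
  @bracket_cross n sigma F a b v nat c l d r r' s t nodes K e i.
rewrite (expand _ _ _ _ _ _ _ _ _ c1) // !(expand _ _ _ _ _ _ _ _ _ c2);
  try exact: link_invariant_cat.
have -> : bracket (update [::] (fun=> [::]) g) R K2 = K2 [:: (0, 2); (3, 5)]%N.
  case: rA rB @R {labR colE h2 L vs labL colL c1 c2} => [] [] /=;
  rewrite /smoothings /= !big_seq1 /= !mul1r; apply: inv2 => x y;
  rewrite !adj_joins /= ?(joins_swap _ _ 2%N) ?(joins_swap _ _ 5%N) //.
rewrite /= /update /=.
have := coef_inverse (erefl (turn l (~~ rB) (g 0%N))) (erefl (turn l rA (g 3%N))).
move=> /=.
reduce_links h1 K1 I.
reduce_links h2 K2 (@nil nat).
rewrite ?expr0 ?expr1 ?mul1r.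
move: (K [:: (0, 2); (3, 5)]%N) (K [:: (0, 3); (2, 5)]%N) => Kv Kh.
repeat match goal with |- context [K ?l] => move: (K l) => ? end.
move: (coefV _ _ _ _ _ _) (coefH _ _ _ _ _ _) (coefX _ _ _ _ _ _) => V1 H1 X1.
move: (coefV _ _ _ _ _ _) (coefH _ _ _ _ _ _) (coefX _ _ _ _ _ _) => V2 H2 X2.
(* [Kv] is the state of two separate strands, reached from two vertical smoothings and also from two
   virtual crossings; the coefficient of [Kh], where the strands turn back, is zero. *)
case=> [[-> -> eV _ eH]|[-> -> -> -> eX]].
  transitivity (V1 * V2 * Kv + (V1 * H2 + H1 * V2 + H1 * H2 * circle) * Kh).
    by ring.
  by rewrite eV eH mul1r mul0r addr0.
by rewrite -[RHS]mul1r -eX; ring.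
Qed.

(** The color on the loop of a kink is the turned color of its entrance, so a classical kink is
    always monochromatic. For positive sign, a times [circle] plus b is [writhe_unit], which
    [weight] divides out; negative sign gives its inverse. *)
Lemma coef_kink l d x :
  let y := turn l d x in
  coefV l d false false x y * circle + coefH l d false false x y
  + coefX l d false false x y = 1.
Proof.
rewrite /coefV /coefH /coefX /matching /= !addbF.
case: l; last by rewrite mul0r !add0r /weight expr0z.
all: rewrite /writhe_unit; case: d => /=; rewrite ?permKV eqxx /=.
all: rewrite addr0 /weight /writhe_unit /circle ?expr1z ?exprN1; field.
all: by rewrite oppr_eq0 expf_neq0 ?a0 ?b0.
Qed.

Lemma reidemeister1_local l d :
  locally_equivalent [:: cross l d false false (0, 1) (1, 2)]%N [:: Point 0 2]%N
    [:: 1]%N [::] [:: 0]%N [::] (fun g => [:: turn l d (g 0%N)]) (fun=> [::]).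
Proof.
set L := [:: _]; set R := [:: _]; set I := [:: _]; set vs := fun g => [:: _].
have labL : {subset iota 0 3 <= labels L} by apply/allP; case: d @L @vs.
have labR : {subset [:: 0; 2]%N <= labels R} by apply/allP.
have colE g : all (colored (update I vs g)) L =
              all (colored (update [::] (fun=> [::]) g)) R.
  rewrite /L /R /= !colored_cross /= /update /= addbF eqxx !andbT.
  by case: l d {L vs labL} => [] [] /=; rewrite ?perm1 ?permK ?permKV.
split=> //.
- split=> //.
  + by apply/allP; case: d @L @vs {labL labR colE}.
  + by move=> g g' gg'; rewrite /vs !gg'.
  + move=> g /=; rewrite !colored_cross /= addbF.
    by case/andP=> /andP[/eqP->].
- by apply/allP; case: d @L @vs {labL labR colE}.
- by apply/allP; case: d @L @vs {labL labR colE}.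
- by apply: perm_mem; case: d @L @vs {labL labR colE}.
- by apply/allP; case: d @L @vs {labL labR colE}.
move=> g K K1 K2 colL inv1 inv2 /(reduces_sub labL) h1 /(reduces_sub labR) h2.
have /andP[c1 _] := colL.
rewrite (@bracket_cross n sigma F a b v nat _ _ _ _ _ _ _ _ _ inv1 c1).
rewrite /= /smoothings /= big_seq1 /= mul1r /update /=.
reduce_links h1 K1 I.
reduce_links h2 K2 (@nil nat).
rewrite ?expr0 ?expr1 ?mul1r.
by rewrite mulrA -!mulrDl coef_kink mul1r.
Qed.

End Local.

(** * From a disc to the diagram *)

Lemma index_map_uniq (T1 T2 : eqType) (f : T1 -> T2) s x :
  uniq (map f s) -> x \in s -> index (f x) (map f s) = index x s.
Proof.
move=> us xs; rewrite -{1}(nth_index x xs) -(nth_map x (f x)) ?index_mem //.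
by rewrite index_uniq // size_map index_mem.
Qed.

Lemma uniq_map_inj_in (T1 T2 : eqType) (f : T1 -> T2) s :
  uniq (map f s) -> {in s &, injective f}.
Proof.
move=> us x y xs ys fxy.
by rewrite -(nth_index x xs) -(index_map_uniq us xs) fxy index_map_uniq ?nth_index.
Qed.

Section Global.
Variables (n : nat) (sigma : {perm 'I_n}) (F : fieldType) (a b v : F).
Variable c0 : 'I_n.
Local Open Scope ring_scope.

Local Notation circle := (circle a b).
Local Notation bracket := (bracket a b v).
Local Notation colored := (colored sigma).
Local Notation statesum := (statesum sigma a b v c0).
Local Notation supported := (supported c0).

Section Transport.
Variables (T : finType) (rho : nat -> T).
Variables (L : seq (node nat)) (rest : seq (node T)) (I ext : seq nat) (V : seq T).
Variable vs : (nat -> 'I_n) -> seq 'I_n.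
Hypothesis extL : extension sigma L I ext vs.
Hypothesis insE : ins (map (map_node rho) L ++ rest) =i map rho I ++ V.
Hypothesis restV : {subset labels rest <= V}.
Hypothesis injI : uniq (map rho I).
Hypothesis disjI : all (fun y => rho y \notin V) I.
Hypothesis labL : {in labels L, forall i, i \notin I -> rho i \in V}.

Definition recolor (c : {ffun T -> 'I_n}) : {ffun T -> 'I_n} :=
  [ffun x => nth (c x) (vs (c \o rho)) (index x (map rho I))].

Lemma outer_notin x : x \in V -> x \notin map rho I.
Proof.
move=> xV; apply/mapP => -[y yI xy].
by move: (allP disjI _ yI); rewrite -xy xV.
Qed.

Lemma recolorN c x : x \notin map rho I -> recolor c x = c x.
Proof.
move=> xI; rewrite ffunE nth_default // (ext_size extL) -(size_map rho).
by rewrite memNindex.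
Qed.

Lemma recolor_update c : {in labels L, recolor c \o rho =1 update I vs (c \o rho)}.
Proof.
move=> i iL; rewrite /= ffunE /update /=; congr nth.
case: (boolP (i \in I)) => iI; first exact: index_map_uniq.
rewrite [index i I]memNindex // memNindex ?size_map //.
apply/mapP => -[y yI iy]; move: (allP disjI _ yI).
by rewrite -iy labL.
Qed.

(** Inner colors are forced by the outer ones, so erasing and recomputing them are inverse
    bijections. The resulting sum ranges over colorings of [V] only, which makes the two sides of a
    move comparable. *)
Lemma statesum_extension :
  statesum (map (map_node rho) L ++ rest) =
  \sum_(c | supported V c && (all (colored (update I vs (c \o rho))) L &&
                              all (colored c) rest))
    bracket c rest (fun m => bracket (update I vs (c \o rho)) L
      (fun k => circle ^+ curves (map rho I ++ V) (map (map_link rho) k ++ m))).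
Proof.
pose erase (c : {ffun T -> 'I_n}) : {ffun T -> 'I_n} :=
  [ffun x => if x \in map rho I then c0 else c x].
rewrite /statesum (reindex_onto recolor erase) /=.
  apply: eq_big => [c|c _].
    rewrite (eq_supported _ insE) all_cat all_colored_map.
    rewrite (eq_in_all_colored _ (@recolor_update c)).
    rewrite (eq_in_all_colored _ (c' := c)) => [|x /restV/outer_notin];
      last exact: recolorN.
    rewrite andbAC; congr (_ && _).
    apply/andP/idP => [[/forallP sc /eqP ec]|/forallP sc].
      apply/forallP=> x; case: (boolP (x \in map rho I)) => xI.
        by rewrite -ec ffunE xI eqxx orbT.
      move: (sc x); rewrite mem_cat (negPf xI) /=.
      by rewrite recolorN.
    split.
      apply/forallP=> x; rewrite mem_cat; case: (boolP (x \in map rho I)) => //= xI.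
      by rewrite recolorN.
    apply/eqP/ffunP=> x; rewrite ffunE; case: ifP => xI.
      case/orP: (sc x) => [/outer_notin|/eqP-> //].
      by rewrite xI.
    by rewrite recolorN ?xI.
  rewrite bracket_cat bracket_exchange.
  rewrite (eq_in_bracket _ _ _ _ (c' := c)) => [|x /restV/outer_notin];
      last exact: recolorN.
  apply: eq_bracket => m; rewrite bracket_map.
  rewrite (eq_in_bracket _ _ _ _ (@recolor_update c)).
  by apply: eq_bracket => k; congr (_ ^+ _); apply: eq_curves.
move=> c /andP[/forallP sc]; rewrite all_cat all_colored_map => /andP[/(ext_val extL) vsc _].
have vse : vs (erase c \o rho) = map (c \o rho) I.
  rewrite -vsc; apply: (ext_eq extL) => i /(ext_labels extL)/andP[iL iI].
  by rewrite /= ffunE (negPf (outer_notin (labL iL iI))).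
apply/ffunP=> x; rewrite ffunE vse.
case: (boolP (x \in map rho I)) => xI.
  rewrite map_comp (nth_map x) ?index_mem ?size_map //.
  by rewrite nth_index.
by rewrite nth_default ?ffunE ?(negPf xI) // memNindex // !size_map.
Qed.

End Transport.

Lemma adj_map_eq (T1 T2 : eqType) (f : T1 -> T2) k k' : adj k =2 adj k' ->
  adj (map (map_link f) k) =2 adj (map (map_link f) k').
Proof.
move=> kk' x y; apply/adj_map/adj_map => -[u [w [kuw -> ->]]]; exists u, w.
  by rewrite -kk'.
by rewrite kk'.
Qed.

(** An inner label both starts and ends in the disc, and every edge starts and ends once, so it
    cannot occur in [rest]; thus only [V] is shared with the outside. *)
Lemma statesum_local (T : finType) (rho : nat -> T) L R rest I I' ext ext' vs vs' :
  locally_equivalent sigma a b v L R I I' ext ext' vs vs' ->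
  uniq (ins (map (map_node rho) L ++ rest)) ->
  perm_eq (ins (map (map_node rho) L ++ rest))
          (outs (map (map_node rho) L ++ rest)) ->
  statesum (map (map_node rho) L ++ rest) =
  statesum (map (map_node rho) R ++ rest).
Proof.
move=> loc; set l := _ ++ rest => ui io.
have uo : uniq (outs l) by rewrite -(perm_uniq io).
have lab_ins : labels l =i ins l.
  by move=> x; rewrite labelsE -(perm_mem io) orbb.
have insl : ins l = map rho (ins L) ++ ins rest by rewrite ins_cat ins_map.
have outsl : outs l = map rho (outs L) ++ outs rest by rewrite outs_cat outs_map.
move: ui uo; rewrite insl outsl !cat_uniq => /and3P[ui /hasPn uir _] /and3P[uo /hasPn uor _].
have inj_in := uniq_map_inj_in ui; have inj_out := uniq_map_inj_in uo.
pose V := [seq x <- ins l | x \notin map rho I].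
(* [rho] is injective on incoming and on outgoing labels separately. Inner labels belong to both
   lists, so no other label is identified with them. *)
have labL : {in labels L, forall i, i \notin I -> rho i \in V}.
  move=> i iL iI; rewrite labelsE in iL.
  have il : rho i \in labels l.
    rewrite labelsE insl outsl !mem_cat; case/orP: iL => iL; apply/orP.
      by left; rewrite map_f.
    by right; rewrite map_f.
  rewrite mem_filter -lab_ins il andbT; apply/mapP => -[y yI iy]; case/negP: iI.
  case/orP: iL => iL.
    by rewrite (inj_in _ _ iL (loc_in loc yI) iy).
  by rewrite (inj_out _ _ iL (loc_out loc yI) iy).
have restV : {subset labels rest <= V}.
  move=> x; rewrite labelsE => xr.
  have xl : x \in labels l.
    rewrite labelsE insl outsl !mem_cat.
    by case/orP: xr => ->; rewrite ?orbT.
  rewrite mem_filter -lab_ins xl andbT; apply/mapP => -[y yI xy]; case/orP: xr => xr.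
    by move/negP: (uir _ xr); apply; rewrite xy map_f // (loc_in loc).
  by move/negP: (uor _ xr); apply; rewrite xy map_f // (loc_out loc).
have disjI : all (fun y => rho y \notin V) I.
  by apply/allP=> y yI; rewrite mem_filter map_f.
have uniqI J : {subset J <= I} -> uniq J -> uniq (map rho J).
  move=> JI; rewrite map_inj_in_uniq // => x y /JI/(loc_in loc) xL /JI/(loc_in loc).
  exact: inj_in.
have injI : uniq (map rho I).
  by apply: uniqI => //; exact: ext_uniq (loc_left loc).
have injI' : uniq (map rho I').
  by apply: uniqI (loc_inner loc) _; exact: ext_uniq (loc_right loc).
have disjI' : all (fun y => rho y \notin V) I'.
  by apply/allP=> y /(loc_inner loc)/(allP disjI).
have labR : {in labels R, forall i, i \notin I' -> rho i \in V}.
  move=> i /(loc_labels loc)/orP[->//|/andP[iL iI] _].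
  exact: labL.
have insL : ins l =i map rho I ++ V.
  move=> x; rewrite mem_cat mem_filter; case: (boolP (x \in map rho I)) => //=.
  by case/mapP=> y /(loc_in loc) yL ->; rewrite insl mem_cat map_f.
have insR : ins (map (map_node rho) R ++ rest) =i map rho I' ++ V.
  move=> x; rewrite ins_cat ins_map !mem_cat; apply/orP/orP.
    case=> [/mapP[i iR ->]|xr].
      case: (boolP (i \in I')) => iI; first by left; rewrite map_f.
      by right; apply: labR => //; rewrite labelsE iR.
    by right; apply: restV; rewrite labelsE xr.
  case=> [/mapP[i iI ->]|].
    by left; rewrite map_f // (loc_ins loc) mem_cat iI.
  rewrite mem_filter insl mem_cat => /andP[xI /orP[/mapP[i iL xi]|->]]; last by right.
  left; rewrite xi map_f // (loc_ins loc) mem_cat mem_filter iL andbT.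
  by apply/orP; right; apply: contra xI => iI; rewrite xi map_f.
rewrite (statesum_extension (loc_left loc) insL restV injI disjI labL).
rewrite (statesum_extension (loc_right loc) insR restV injI' disjI' labR).
apply: eq_big => [c|c /and3P[_ cL _]]; first by rewrite (loc_colored loc).
apply: eq_bracket_within => m /(sub_within restV) mV.
have inv J : link_invariant (fun k =>
    circle ^+ curves (map rho J ++ V) (map (map_link rho) k ++ m)).
  move=> k k' kk'; congr (_ ^+ _); apply: eq_curves => // x y.
  by rewrite !adj_cat (adj_map_eq _ kk').
apply: (loc_bracket loc (K := fun k =>
  circle ^+ curves V (map (map_link rho) k ++ m))) => //.
  move=> k kL; rewrite -exprD -curves_reduce // => u w.
  by move=> kuw; apply: labL; case: (withinP _ _ kL _ _ kuw).
move=> k kR; rewrite -exprD -curves_reduce // => u w.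
by move=> kuw; apply: labR; case: (withinP _ _ kR _ _ kuw).
Qed.

End Global.

(** * Marked points and the assembly of the moves *)

Lemma curves_diag (T : finType) (V : seq T) x k :
  curves V ((x, x) :: k) = curves V k.
Proof.
apply: eq_n_comp => s t; apply/idP/idP; apply: connect_sub => {s t} s t;
  rewrite ?(adj_cat [:: (x, x)] k).
  case/orP=> [|kst]; last exact: connect1.
  rewrite /adj /= !inE !xpair_eqE => /orP[] /andP[/eqP-> /eqP->];
  exact: connect0.
by move=> kst; apply: connect1; rewrite (adj_cat [:: (x, x)] k) kst orbT.
Qed.

Lemma map_node_comp (E1 E2 E3 : Type) (f : E1 -> E2) (g : E2 -> E3) x :
  map_node g (map_node f x) = map_node (g \o f) x.
Proof. by case: x. Qed.

Lemma eq_in_map_node (E1 E2 : eqType) (f g : E1 -> E2) l :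
  {in labels l, f =1 g} -> map (map_node f) l = map (map_node g) l.
Proof.
elim: l => //= x l IHl fg; congr (_ :: _); last first.
  by apply: IHl => e el; apply: fg; rewrite labels_cons mem_cat el orbT.
have {}fg e : e \in endpoints x -> f e = g e.
  by move=> ex; apply: fg; rewrite labels_cons mem_cat ex.
by case: x fg => [k p q|i o] fg /=; rewrite !fg // !inE eqxx ?orbT.
Qed.

Section Moves.
Variables (n : nat) (sigma : {perm 'I_n}) (F : fieldType) (a b v : F).
Variable c0 : 'I_n.
Local Open Scope ring_scope.

Local Notation statesum := (statesum sigma a b v c0).

(** The marked point forces equal colors on x and y, and its only link is contracted to a self-link
    of x. *)
Lemma statesum_unmark (T : finType) (x y : T) l : x != y ->
  uniq (ins (Point x y :: l)) ->
  perm_eq (ins (Point x y :: l)) (outs (Point x y :: l)) ->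
  statesum (Point x y :: l) = statesum (map (map_node (rename y x)) l).
Proof.
move=> xy ui io; set ren := rename y x.
pose V := [seq z <- x :: ins l | z != y].
have yV : y \notin V by rewrite mem_filter eqxx.
have xV : x \in V by rewrite mem_filter xy mem_head.
have renx : ren x = x by rewrite /ren /rename (negPf xy).
have reny : ren y = x by rewrite /ren /rename eqxx.
have renV z : z \in V -> ren z = z.
  by rewrite mem_filter /ren /rename => /andP[/negPf->].
(* The edge y must end somewhere, and not at the marked point, where only x ends. *)
have yl : y \in ins l.
  have : y \in ins (Point x y :: l) by rewrite (perm_mem io) mem_head.
  by rewrite inE eq_sym (negPf xy).
have insL : ins (Point x y :: l) =i y :: V.
  move=> z; rewrite [in RHS]inE mem_filter; case: eqP => //= ->.
  by rewrite mem_behead.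
have insR : ins (map (map_node ren) l) =i V.
  move=> z; rewrite ins_map; apply/mapP/idP => [[e el ->]|].
    case: (eqVneq e y) => [->|ey]; first by rewrite reny.
    by rewrite renV mem_filter ey inE el orbT.
  rewrite mem_filter inE => /andP[zy /predU1P[->|zl]]; first by exists y.
  by exists z => //; rewrite /ren /rename (negPf zy).
have labl : {subset labels l <= y :: V}.
  move=> z zl; rewrite -insL; move: zl; rewrite labelsE.
  case/orP => zl; first by rewrite mem_behead.
  by rewrite (perm_mem io) mem_behead.
pose recolor (c : {ffun T -> 'I_n}) : {ffun T -> 'I_n} := [ffun z => c (ren z)].
pose erase (c : {ffun T -> 'I_n}) : {ffun T -> 'I_n} :=
  [ffun z => if z == y then c0 else c z].
rewrite /statesum (reindex_onto recolor erase) /=.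
  apply: eq_big => [c|c _].
    rewrite (eq_supported _ insL) (eq_supported _ insR) all_colored_map.
    rewrite !ffunE renx reny eqxx /= andbAC.
    rewrite (eq_in_all_colored _ (c' := c \o ren)) => [|z _]; last by rewrite ffunE.
    congr (_ && _); apply/andP/forallP => [[/forallP sc /eqP ec] z|sc].
      case: (eqVneq z y) => [->|zy].
        by rewrite -ec ffunE eqxx eqxx orbT.
      by move: (sc z); rewrite ffunE inE (negPf zy) /ren /rename (negPf zy).
    split.
      apply/forallP=> z; rewrite inE; case: (eqVneq z y) => //= zy.
      by rewrite ffunE /ren /rename (negPf zy).
    apply/eqP/ffunP=> z; rewrite !ffunE; case: eqP => [->|zy].
      by case/orP: (sc y) => [|/eqP->//]; rewrite (negPf yV).
    by rewrite /ren /rename; case: eqP.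
  rewrite big_seq1 mul1r bracket_map.
  rewrite (eq_in_bracket _ _ _ _ (c' := c \o ren)) => [|z _]; last by rewrite ffunE.
  apply: eq_bracket_within => k kl; congr (_ ^+ _).
  rewrite (eq_curves (V' := y :: V) (k' := (x, y) :: k)) //.
  rewrite (@curves_contract _ V _ x) //=.
  - rewrite /map_link /= -/ren renx reny curves_diag.
    by apply: eq_curves => // z; rewrite insR.
  - by rewrite /adj /= !inE eqxx orbT.
  - by rewrite !inE eqxx xV orbT (sub_within labl kl).
move=> c /andP[/forallP sc /andP[/eqP cy _]]; apply/ffunP=> z; rewrite !ffunE.
case: (eqVneq z y) => [->|zy]; first by rewrite reny (negPf xy).
by rewrite /ren /rename (negPf zy) (negPf zy).
Qed.

(** The names in a move may repeat; [nth] looks them up from the distinct numerals of the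
    template. *)
Lemma disc_move_local (L R : seq (node nat)) :
  a != 0 -> b != 0 -> v != 0 -> disc_move L R ->
  exists rho L0 R0, exists I I' ext ext' vs vs',
  [/\ locally_equivalent sigma a b v L0 R0 I I' ext ext' vs vs',
      L = map (map_node rho) L0 & R = map (map_node rho) R0].
Proof.
move=> a0 b0 v0; case.
- move=> l d x0 x1 x2; exists (nth 0%N [:: x0; x1; x2]).
  do 8!eexists; split; first exact: (reidemeister1_local sigma v a0 b0 l d).
    by rewrite /= map_cross.
  by [].
- move=> l rA rB x0 x1 x2 y0 y1 y2.
  exists (nth 0%N [:: x0; x1; x2; y0; y1; y2]).
  do 8!eexists; split; first exact: (reidemeister2_local sigma a0 b0 v0 l rA rB).
    by rewrite /= !map_cross.
  by case: rA rB => [] [].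
move=> lAB lAC lBC rA rB rC x0 x1 x2 y0 y1 y2 z0 z1 z2 tri.
exists (nth 0%N [:: x0; x1; x2; y0; y1; y2; z0; z1; z2]).
do 8!eexists; split.
- exact: (reidemeister3_local sigma v a0 b0 rA rB rC tri).
- by rewrite /= !map_cross.
by rewrite /= !map_cross.
Qed.

End Moves.

(** Below the bound [N] the map [inord] is injective. As [N] may be any bound, a common one puts
    both diagrams of a move into one finite type. *)
Lemma describes_statesum (n : nat) (sigma : {perm 'I_n}) (c0 : 'I_n)
    (D : diagram) (l : seq (node nat)) (N : nat) :
  describes D l -> {in labels l, forall e, e <= N} ->
  let l' := map (map_node (inord : nat -> 'I_N.+1)) l in
  [/\ permutation_jones sigma D = statesum sigma var_a var_b var_v c0 l',
      uniq (ins l') & perm_eq (ins l') (outs l')].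
Proof.
case=> f injf; set nodes := [seq node_at x | x <- enum (vertex D)] => fl lN l'.
have nodesE : [seq map_node f (node_at x) | x <- enum (vertex D)] =
              map (map_node f) nodes by rewrite /nodes -map_comp.
rewrite nodesE in fl.
have ins_enum : perm_eq (ins nodes) (enum (edge D)).
  by rewrite /ins /nodes -map_comp; exact: edge_ends.
have outs_enum : perm_eq (outs nodes) (enum (edge D)).
  by rewrite /outs /nodes -map_comp; exact: edge_starts.
pose g e : 'I_N.+1 := inord (f e).
have fN e : f e <= N.
  apply: lN; rewrite labelsE -(perm_mem (perm_ins fl)) ins_map map_f //.
  by rewrite (perm_mem ins_enum) mem_enum.
have injg : injective g.
  by move=> e e' /(congr1 val); rewrite /= !inordK ?ltnS // => /injf.
have gl : perm_eq (map (map_node g) nodes) l'.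
  have -> : map (map_node g) nodes = map (map_node inord) (map (map_node f) nodes).
    by rewrite -map_comp; apply: eq_map => x /=; rewrite map_node_comp.
  exact: perm_map.
split.
- rewrite (permutation_jones_statesum sigma c0) -(statesum_perm _ _ _ _ _ gl).
  by rewrite statesum_map // => e; rewrite (perm_mem ins_enum) mem_enum.
- rewrite -(perm_uniq (perm_ins gl)) ins_map map_inj_uniq //.
  by rewrite (perm_uniq ins_enum) enum_uniq.
rewrite -(permPl (perm_ins gl)) -(permPr (perm_outs gl)) ins_map outs_map.
by apply: perm_map; rewrite (permPl ins_enum) perm_sym.
Qed.

Lemma permutation_jones_move (n : nat) (sigma : {perm 'I_n}) (c0 : 'I_n)
    (D D' : diagram) :
  diagram_move D D' -> permutation_jones sigma D = permutation_jones sigma D'.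
Proof.
have bound l l' : exists N, {in labels l, forall e, e <= N} /\
                            {in labels l', forall e, e <= N}.
  exists (\max_(e <- labels l ++ labels l') e).
  by split=> e el; apply: leq_bigmax_seq => //; rewrite mem_cat el ?orbT.
case=> [l Dl D'l|a b l ab Dl D'l|L R rest LR Dl D'l].
- have [N [lN _]] := bound l l.
  have [-> _ _] := describes_statesum sigma c0 Dl lN.
  by have [-> _ _] := describes_statesum sigma c0 D'l lN.
- have [N [lN l'N]] := bound (Point a b :: l) (map (map_node (rename b a)) l).
  have [-> ui io] := describes_statesum sigma c0 Dl lN.
  have [-> _ _] := describes_statesum sigma c0 D'l l'N.
  have aN : a <= N by apply: lN; rewrite labels_cons !inE eqxx.
  have bN : b <= N by apply: lN; rewrite labels_cons !inE eqxx orbT.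
  have inordI i j : i <= N -> j <= N ->
      ((inord i : 'I_N.+1) == inord j) = (i == j).
    by move=> iN jN; rewrite -val_eqE /= !inordK.
  rewrite statesum_unmark ?inordI //; congr statesum.
  rewrite -!map_comp.
  rewrite (eq_map (map_node_comp _ _)) [RHS](eq_map (map_node_comp _ _)).
  apply: eq_in_map_node => e el /=.
  rewrite /rename inordI //; first by case: ifP.
  by apply: lN; rewrite labels_cons !inE el !orbT.
have [a0 b0 v0] := variables_neq0.
have [N [lN l'N]] := bound (L ++ rest) (R ++ rest).
have [-> ui io] := describes_statesum sigma c0 Dl lN.
have [-> _ _] := describes_statesum sigma c0 D'l l'N.
have [rho [L0 [R0 [I [I' [ext [ext' [vs [vs' [loc eL eR]]]]]]]]]] :=
  disc_move_local sigma a0 b0 v0 LR.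
have inordE (X Y : seq (node nat)) : map (map_node (inord : nat -> 'I_N.+1))
    (map (map_node rho) X ++ Y) =
    map (map_node (inord \o rho)) X ++ map (map_node inord) Y.
  rewrite map_cat; congr cat; rewrite -map_comp.
  by apply: eq_map => x /=; rewrite map_node_comp.
move: ui io; rewrite eL eR !inordE; exact: statesum_local loc.
Qed.

Theorem theorem2 (n : nat) (sigma : {perm 'I_n}) (hn : 1 <= n)
  (D D' : diagram) :
  reidemeister_equivalent D D' ->
  permutation_jones sigma D = permutation_jones sigma D'.
Proof.
elim=> [X Y|//|X Y _ ->|X Y Z _ -> _ ->] //.
(* The default color is the element 0, which exists since [1 <= n]. *)
exact: (permutation_jones_move sigma (Ordinal hn)).
Qed.
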